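(* Let $P,Q\subset N_{\mathbb{Q}}$ be Fano polygons. Suppose they are related by a mutation, i.e. $Q=\mathrm{mut}_w(P,F)$ for some primitive $w\in M$ and some factor $F$ of $P$ with respect to $w$. Then the directed singularity contents of $P$ and $Q$ coincide: $\mathrm{SC}(P)=\mathrm{SC}(Q)$.
   Context: Let $N\cong\mathbb{Z}^2$, $M=\mathrm{Hom}(N,\mathbb{Z})$, $N_{\mathbb{Q}}=N\otimes\mathbb{Q}$. A convex lattice polygon $P\subset N_{\mathbb{Q}}$ is Fano if the origin lies in its strict interior and every vertex $(x,y)$ satisfies $\gcd(x,y)=1$. Mutation: let $P$ be a Fano polygon and $w\in M$ primitive. Put $h_{\min}=\min_{x\in P}w(x)$, $h_{\max}=\max_{x\in P}w(x)$. For an integer $h$ let $N_h=\{x\in N: w(x)=h\}$, $P_h=\mathrm{conv}(P\cap N_h)$, and let $\mathcal{V}(P)_h$ be the set of vertices of $P$ lying in $N_h$. A lattice polytope $F\subset N_{\mathbb{Q}}$ is a factor of $P$ with respect to $w$ if $w(F)=\{0\}$ and for every integer $h$ with $h_{\min}\le h<0$ there is a (possibly empty) lattice polytope $R_h\subset N_{\mathbb{Q}}$ with $\mathcal{V}(P)_h\subseteq R_h+|h|F\subseteq P_h$. The mutation of $P$ with respect to $w$ and $F$ is $\mathrm{mut}_w(P,F)=\mathrm{conv}\big(\bigcup_{h=h_{\min}}^{-1}R_h\cup\bigcup_{h=0}^{h_{\max}}(P_h+hF)\big)$ (it does not depend on the choice of the $R_h$). Edges: an edge $E$ of a Fano polygon,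 with primitive inner normal $u\in M$, has length $\ell_E=|E\cap N|-1$ and height $h_E=|u(v)|$, $v$ a vertex of $E$. For a pointed full-dimensional cone $\sigma$ with primitive ray generators $v_0,v_1$ in anticlockwise order, its Hermite normal form $H_\sigma$ is the row-style Hermite normal form of the matrix with left column $v_0$ and right column $v_1$, i.e. the unique matrix $\begin{pmatrix}1&a\\0&r\end{pmatrix}$ with $0\le a<r$ obtained from it by left multiplication by a unimodular integer matrix; the Hermite normal form of an edge (or of a lattice segment with primitive endpoints) is that of the cone over it. Directed singularity content: write $\ell_E=n_Eh_E+\tilde\ell$ with $n_E\ge0$ and $0\le\tilde\ell<h_E$. Subdivide $E$ into $n_E$ segments of length $h_E$ and a (possibly empty) segment $\mathrm{res}(E)$ of length $\tilde\ell$. Put $\mathrm{res}(H_E)=H_{\mathrm{res}(E)}$ if $\tilde\ell>0$ and $\mathrm{res}(H_E)=\varnothing$ otherwise (this is independent of the position of $\mathrm{res}(E)$ in the subdivision). Let $n_P=\sum_E n_E$, and let the directed basket $\overrightarrow{\mathcal{B}}_P$ be the cyclically ordered set (with repetitions) of the non-empty $\mathrm{res}(H_E)$, taken over the edges $E$ of $P$ in anticlockwise order. The directed singularity content is $\mathrm{SC}(P)=(n_P,\overrightarrow{\mathcal{B}}_P)$; cyclically ordered sets are equal if they agree up to cyclic rotation. *)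

(* Defs.v *)
From HB Require Import structures.
From mathcomp Require Import all_boot all_order all_algebra finmap.
From mathcomp Require Import boolp classical_sets cardinality.

Set Implicit Arguments.
Unset Strict Implicit.
Unset Printing Implicit Defensive.

Import Order.TTheory GRing.Theory Num.Theory.

Local Open Scope classical_set_scope.
Local Open Scope ring_scope.

(** A basis of the lattice N is fixed: elements of N are integer columns (x, y)^T,
    elements of M = Hom(N, Z) are integer rows acting by matrix product, and
    "anticlockwise" refers to the orientation in which this basis is positive. *)
Notation latN := 'cV[int]_2.
Notation latM := 'rV[int]_2.
Notation spaceNQ := 'cV[rat]_2.

Definition emb (v : latN) : spaceNQ := map_mx intr v.
Definition evN (w : latM) (v : latN) : int := (w *m v) 0 0.
Definition evQ (w : latM) (x : spaceNQ) : rat := (map_mx intr w *m x) 0 0.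

Definition primitiveN (v : latN) : Prop := gcdz (v 0 0) (v 1 0) = 1.
Definition primitiveM (w : latM) : Prop := gcdz (w 0 0) (w 0 1) = 1.

(** * Rational polytopes as subsets of N_Q *)

Definition conv (A : set spaceNQ) : set spaceNQ :=
  [set x | exists (k : nat) (c : 'I_k -> rat) (p : 'I_k -> spaceNQ),
     [/\ forall i, 0 <= c i, forall i, A (p i),
         \sum_(i < k) c i = 1 & x = \sum_(i < k) c i *: p i]].

Definition lattice_polytope (P : set spaceNQ) : Prop :=
  exists s : seq latN, P = conv (emb @` [set` s]).

Definition minkowski (A B : set spaceNQ) : set spaceNQ :=
  [set x + y | x in A & y in B].

Definition dilate (c : rat) (A : set spaceNQ) : set spaceNQ :=
  [set c *: x | x in A].

Definition face (P : set spaceNQ) (u : latM) : set spaceNQ :=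
  [set x | P x /\ forall y, P y -> evQ u x <= evQ u y].

Definition vertex (P : set spaceNQ) (v : latN) : Prop :=
  exists u : latM, face P u = [set emb v].

Definition origin_in_interior (P : set spaceNQ) : Prop :=
  exists2 eps : rat, 0 < eps &
    forall x : spaceNQ, (forall i, `|x i 0| < eps) -> P x.

Definition fano (P : set spaceNQ) : Prop :=
  [/\ lattice_polytope P, origin_in_interior P &
      forall v, vertex P v -> primitiveN v].

(** * Mutations *)

(* The default value 0 of [xget] is not used when the extremum is attained,
   as it is for a linear form on a nonempty polytope. *)
Definition hmin (P : set spaceNQ) (w : latM) : rat :=
  xget 0 ((evQ w @` P) `&` lbound (evQ w @` P)).
Definition hmax (P : set spaceNQ) (w : latM) : rat :=
  xget 0 ((evQ w @` P) `&` ubound (evQ w @` P)).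

Definition slice (P : set spaceNQ) (w : latM) (h : int) : set spaceNQ :=
  conv (P `&` [set emb v | v in [set v : latN | evN w v = h]]).

Definition vertices_at (P : set spaceNQ) (w : latM) (h : int) : set spaceNQ :=
  [set emb v | v in [set v : latN | vertex P v /\ evN w v = h]].

Definition remainder (P : set spaceNQ) (w : latM) (F : set spaceNQ) (h : int)
    (R : set spaceNQ) : Prop :=
  [/\ lattice_polytope R,
      vertices_at P w h `<=` minkowski R (dilate `|h|%:~R F) &
      minkowski R (dilate `|h|%:~R F) `<=` slice P w h].

Definition factor (P : set spaceNQ) (w : latM) (F : set spaceNQ) : Prop :=
  [/\ lattice_polytope F, evQ w @` F = [set 0] &
      forall h : int, hmin P w <= h%:~R -> h < 0 ->
        exists R, remainder P w F h R].

Definition admissible (P : set spaceNQ) (w : latM) (F : set spaceNQ)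
    (R : int -> set spaceNQ) : Prop :=
  forall h : int, hmin P w <= h%:~R -> h < 0 -> remainder P w F h (R h).

(* The choice R of the polytopes R_h is an explicit argument; the result does
   not depend on it as long as it is admissible. *)
Definition mut (P : set spaceNQ) (w : latM) (F : set spaceNQ)
    (R : int -> set spaceNQ) : set spaceNQ :=
  conv (\bigcup_(h in [set h : int | hmin P w <= h%:~R /\ h < 0]) R h `|`
        \bigcup_(h in [set h : int | 0 <= h /\ h%:~R <= hmax P w])
          minkowski (slice P w h) (dilate h%:~R F)).

(** * Edges, in anticlockwise order *)

Definition two_columns (v0 v1 : latN) : 'M[int]_2 := row_mx v0 v1.

(* An edge is recorded with its primitive inner normal u and its two endpoints,
   the pair (v0, v1) being in anticlockwise order as seen from the origin. *)
Definition edge_data : choiceType := (latM * (latN * latN))%type.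
Definition normal (E : edge_data) : latM := E.1.
Definition source (E : edge_data) : latN := E.2.1.
Definition target (E : edge_data) : latN := E.2.2.
Definition segment (E : edge_data) : set spaceNQ :=
  conv [set emb (source E); emb (target E)].

Definition is_edge (P : set spaceNQ) (E : edge_data) : Prop :=
  [/\ primitiveM (normal E), face P (normal E) = segment E &
      0 < \det (two_columns (source E) (target E))].

(* Comparison of the polar angles in [0, 2 pi) of two nonzero vectors: first by
   half-plane, then by the sign of the determinant. *)
Definition lower_half (v : latN) : bool :=
  ~~ ((0 < v 1 0) || ((v 1 0 == 0) && (0 < v 0 0))).
Definition angle_le (v v' : latN) : bool :=
  (lower_half v < lower_half v')%N ||
  (lower_half v == lower_half v') && (0 <= \det (two_columns v v')).

(* [fset_set] enumerates a finite set; a polygon has finitely many edges. *)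
Definition edges (P : set spaceNQ) : seq edge_data :=
  sort (fun E E' => angle_le (source E) (source E'))
       (fset_set [set E | is_edge P E]).

Definition edge_length (E : edge_data) : nat :=
  (#|` fset_set [set x : latN | segment E (emb x)]|).-1.
Definition edge_height (E : edge_data) : nat :=
  `|evN (normal E) (source E)|%N.

(** * Directed singularity content *)

Definition is_hermite_form (A H : 'M[int]_2) : Prop :=
  exists2 U : 'M[int]_2, U \in unitmx &
    [/\ H = U *m A, H 0 0 = 1, H 1 0 = 0 & 0 <= H 0 1 < H 1 1].

(* For primitive v0, v1 with positive determinant, exactly one matrix satisfies
   [is_hermite_form]; the default value of [xget] is then irrelevant. *)
Definition hermite (v0 v1 : latN) : 'M[int]_2 :=
  xget 0 [set H | is_hermite_form (two_columns v0 v1) H].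

Definition num_segments (E : edge_data) : nat :=
  (edge_length E %/ edge_height E)%N.
Definition res_length (E : edge_data) : nat :=
  (edge_length E %% edge_height E)%N.

(* The i-th lattice point of the edge, counted from its source; the integer
   divisions are exact. *)
Definition edge_point (E : edge_data) (i : nat) : latN :=
  source E +
    \col_j divz ((target E - source E) j 0) (edge_length E)%:Z *+ i.

(* The segments of length [edge_height E] are laid off from the source, so that
   res(E) is the final piece of E; all its positions give the same form. *)
Definition res_hermite (E : edge_data) : 'M[int]_2 :=
  hermite (edge_point E (num_segments E * edge_height E)) (target E).

Definition num_T (P : set spaceNQ) : nat :=
  (\sum_(E <- edges P) num_segments E)%N.

Definition basket (P : set spaceNQ) : seq 'M[int]_2 :=
  [seq res_hermite E | E <- edges P & (0 < res_length E)%N].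

Definition cyclic_eq (T : Type) (s t : seq T) : Prop := exists k, t = rot k s.

Definition SC (P : set spaceNQ) : nat * seq 'M[int]_2 := (num_T P, basket P).

Definition SC_eq (a b : nat * seq 'M[int]_2) : Prop :=
  a.1 = b.1 /\ cyclic_eq a.2 b.2.

(* Main.v *)
Require Import Defs.
From mathcomp Require Import all_boot all_order all_algebra.
From mathcomp Require Import finmap boolp classical_sets cardinality.
From mathcomp Require Import zify ring lra.

Set Implicit Arguments.
Unset Strict Implicit.
Unset Printing Implicit Defensive.

Import Order.TTheory GRing.Theory Num.Theory.
Local Open Scope classical_set_scope.
Local Open Scope ring_scope.

(** Let f = [dir w], a primitive generator of the kernel of w, so that
    F = [a f, b f] with integers a <= b, and let A_c be the shear
    v |-> v + c w(v) f.  Picture w as pointing up and f as pointing right.  The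
    left part of the boundary of Q = mut_w(P, F) is the image under A_a of the
    left part of the boundary of P, and the right part is the image under A_b.
    A shear is unimodular, hence keeps lengths, heights and Hermite forms, and
    all that changes is the two horizontal faces: the bottom one, at height -h,
    loses (b - a) h of its length and the top one, at height h', gains
    (b - a) h'.  So b - a segments as long as the height disappear at the bottom
    and b - a of them appear at the top.  The residues keep their length; as
    they can be laid off from an end point of the face, and the shears fix f,
    they also keep their Hermite form.

    A face is encoded by its primitive inner normal u and by its two end points.
    An end point is a minimum v of u on the polygon, ties being decided by the
    sign of det(v, x) ([extreme]); this makes sense because the origin is
    interior, so that u(v) < 0.  [extreme_shear] moves such a point from P to Q.
    It rests on two comparisons of P with Q, row by row: no point of Q lies to
    the left of the sheared P ([dominates]), and at the height
    of each sheared vertex of P there is a point of Q at least as far to the left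
    ([dominates_vertices]); on the right the comparisons are the mirror images.
    Both come straight from the definition of a mutation ([mut_dominates],
    [mut_dominates_vertices]).  Faces that are points must be admitted, as a
    horizontal edge may shrink to a vertex or grow out of one: [ext_facet] adds
    the two horizontal faces to the edges, and [transport] is then a bijection
    from the extended edges of P to those of Q.

    The remaining question is the cyclic order.  The edges are listed by polar
    angle of their sources, an order which the two shears do not respect in any
    evident way.  They do respect the order [height_le]: left edges going down,
    then the bottom, then right edges going up, then the top.  Both listings run
    around the polygon, each edge being followed by the one that starts where it
    ends, and a cyclic listing is determined up to rotation by its successor
    function ([fcycle_rot]).  That a sorted list follows a successor function
    amounts to no element being placed between another one and its successor
    ([fcycle_pairwise]); here this is convexity, in the form of
    [no_source_in_cone] for angles and of [no_edge_alongside] and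
    [turning_point] for heights. *)

(** * Coordinates *)

(** The determinant, entrywise, since the polynomial arithmetic below is done on
    coordinates. *)
Definition area (v v' : latN) : int := v 0 0 * v' 1 0 - v' 0 0 * v 1 0.
Definition areaQ (x y : spaceNQ) : rat := x 0 0 * y 1 0 - y 0 0 * x 1 0.

Lemma latND (v v' : latN) i : (v + v') i 0 = v i 0 + v' i 0.
Proof. by rewrite mxE. Qed.
Lemma latNN (v : latN) i : (- v) i 0 = - v i 0.
Proof. by rewrite mxE. Qed.
Lemma latNZ (l : int) (v : latN) i : (l *: v) i 0 = l * v i 0.
Proof. by rewrite mxE. Qed.
Definition latNE := (latND, latNN, latNZ).

Lemma latMD (u u' : latM) i : (u + u') 0 i = u 0 i + u' 0 i.
Proof. by rewrite mxE. Qed.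
Lemma latMN (u : latM) i : (- u) 0 i = - u 0 i.
Proof. by rewrite mxE. Qed.
Lemma latMZ (l : int) (u : latM) i : (l *: u) 0 i = l * u 0 i.
Proof. by rewrite mxE. Qed.
Definition latME := (latMD, latMN, latMZ).

Lemma areaxx v : area v v = 0.
Proof. by rewrite /area subrr. Qed.

Lemma areaBr (v x y : latN) : area v (x - y) = area v x - area v y.
Proof. by rewrite /area !mxE; ring. Qed.

Lemma evNE u v : evN u v = u 0 0 * v 0 0 + u 0 1 * v 1 0.
Proof.
rewrite /evN mxE !big_ord_recl big_ord0 addr0.
by congr (_ * _ + u _ _ * v _ _); apply/val_inj.
Qed.

Lemma evQE u x : evQ u x = (u 0 0)%:~R * x 0 0 + (u 0 1)%:~R * x 1 0.
Proof.
rewrite /evQ mxE !big_ord_recl big_ord0 addr0 !mxE.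
by congr (_ * _ + (u _ _)%:~R * x _ _); apply/val_inj.
Qed.

Lemma evNB u (v v' : latN) : evN u (v - v') = evN u v - evN u v'.
Proof. by rewrite !evNE !mxE; ring. Qed.

Lemma evQ_emb u v : evQ u (emb v) = (evN u v)%:~R.
Proof. by rewrite evQE evNE !mxE rmorphD !rmorphM. Qed.

Lemma area_emb v v' : areaQ (emb v) (emb v') = (area v v')%:~R.
Proof. by rewrite /areaQ !mxE rmorphB !rmorphM. Qed.

Lemma det2 (R : comNzRingType) (M : 'M[R]_2) :
  \det M = M 0 0 * M 1 1 - M 0 1 * M 1 0.
Proof.
rewrite (expand_det_row _ 0) !big_ord_recl big_ord0 addr0 /cofactor !det_mx11 !mxE.
rewrite /= !expr0 expr1 mul1r mulN1r mulrN.
by congr (M _ _ * M _ _ - M _ _ * M _ _); apply/val_inj.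
Qed.

Lemma det_two_columns v v' : \det (two_columns v v') = area v v'.
Proof.
have el i : row_mx v v' i (0 : 'I_2) = v i 0.
  by rewrite -(row_mxEl v v' i 0); congr (row_mx v v' _ _); apply/val_inj.
have er i : row_mx v v' i (1 : 'I_2) = v' i 0.
  by rewrite -(row_mxEr v v' i 0); congr (row_mx v v' _ _); apply/val_inj.
by rewrite det2 /area /two_columns !el !er.
Qed.

Lemma colP2 (R : Type) (x y : 'cV[R]_2) : x 0 0 = y 0 0 -> x 1 0 = y 1 0 -> x = y.
Proof.
move=> h0 h1; apply/colP => i; rewrite -[i]/(_ : 'I_2).
by case: (eqVneq i 0) => [->//|]; case: i => [[|[|i]] hi] //= _;
  rewrite (_ : Ordinal hi = 1) //; apply/val_inj.
Qed.

Lemma rowP2 (R : Type) (x y : 'rV[R]_2) : x 0 0 = y 0 0 -> x 0 1 = y 0 1 -> x = y.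
Proof. by move=> h0 h1; apply/trmx_inj/colP2; rewrite !mxE. Qed.

(** * Convex hulls *)

Definition convexQ (C : set spaceNQ) : Prop := forall x y (l : rat),
  C x -> C y -> 0 <= l <= 1 -> C (l *: x + (1 - l) *: y).

(** Stated for weights of arbitrary positive total so that the induction can drop
    the last point without renormalizing the others. *)
Lemma convexQ_sum (C : set spaceNQ) : convexQ C ->
  forall k (c : 'I_k -> rat) (p : 'I_k -> spaceNQ),
  (forall i, 0 <= c i) -> (forall i, C (p i)) -> 0 < \sum_i c i ->
  C ((\sum_i c i)^-1 *: \sum_i c i *: p i).
Proof.
move=> cvx; elim=> [|k IH] c p c0 Cp; first by rewrite big_ord0 ltxx.
rewrite !big_ord_recr /=; set m := \sum_(i < k) _; set d := c _ => md.
have m0 : 0 <= m by apply: sumr_ge0.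
have d0 : 0 <= d by apply: c0.
have [mz|mnz] := eqVneq m 0.
  have cz i : c (widen_ord (leqnSn k) i) = 0.
    apply/eqP; have /eqP := mz; rewrite psumr_eq0 => [/allP/(_ i)|//].
    by rewrite mem_index_enum => /(_ isT).
  rewrite big1 => [|i _]; last by rewrite cz scale0r.
  move: md; rewrite mz !add0r => dp.
  by rewrite scalerA mulVf ?gt_eqF// scale1r.
have mp : 0 < m by rewrite lt_def mnz.
set wid := widen_ord (leqnSn k).
have Cm := IH (c \o wid) (p \o wid) (fun i => c0 _) (fun i => Cp _) mp.
have := cvx _ _ (m / (m + d)) Cm (Cp ord_max).
rewrite -/m divr_ge0 ?addr_ge0// ler_pdivrMr// mul1r lerDl d0 => /(_ isT).
congr C; rewrite scalerA mulrAC divff ?gt_eqF// mul1r scalerDr scalerA.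
by congr (_ + _ *: _); rewrite -{1}(divff (lt0r_neq0 md)) -mulrBl addrAC subrr add0r mulrC.
Qed.

Lemma conv_min (A C : set spaceNQ) : convexQ C -> A `<=` C -> conv A `<=` C.
Proof.
move=> cvx AC x [k [c [p [c0 Ap s1 ->]]]].
have := convexQ_sum cvx c0 (fun i => AC _ (Ap i)); rewrite s1 invr1 scale1r.
by apply.
Qed.

Lemma sub_conv (A : set spaceNQ) : A `<=` conv A.
Proof.
move=> x Ax; exists 1%N, (fun=> 1), (fun=> x); split => //.
- by rewrite big_ord1.
- by rewrite big_ord1 scale1r.
Qed.

Lemma conv_convex (A : set spaceNQ) : convexQ (conv A).
Proof.
move=> x y l [k [c [p [c0 Ap s1 ->]]]] [k' [c' [p' [c'0 Ap' s1' ->]]]] /andP[l0 l1].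
exists (k + k')%N,
  (fun i => match split i with inl j => l * c j | inr j => (1 - l) * c' j end),
  (fun i => match split i with inl j => p j | inr j => p' j end).
split.
- by move=> i; case: split => j; rewrite mulr_ge0// subr_ge0.
- by move=> i; case: split.
- rewrite big_split_ord /=.
  under eq_bigr => i _ do rewrite (unsplitK (inl i : 'I_k + 'I_k')).
  under [X in _ + X]eq_bigr => i _ do rewrite (unsplitK (inr i : 'I_k + 'I_k')).
  by rewrite -!mulr_sumr s1 s1' !mulr1 addrC subrK.
- rewrite big_split_ord /= !scaler_sumr; congr (_ + _).
  + by apply: eq_bigr => i _; rewrite (unsplitK (inl i : 'I_k + 'I_k')) scalerA.
  + by apply: eq_bigr => i _; rewrite (unsplitK (inr i : 'I_k + 'I_k')) scalerA.
Qed.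

Lemma conv_neq0 (A : set spaceNQ) : conv A !=set0 -> A !=set0.
Proof.
case=> x [[|k] [c [p [_ Ap s1 _]]]]; last by exists (p ord0).
by move: s1; rewrite big_ord0.
Qed.

Lemma conv2P (a b x : spaceNQ) :
  conv [set a; b] x <-> exists2 l : rat, 0 <= l <= 1 & x = l *: a + (1 - l) *: b.
Proof.
split; last first.
  by case=> l l01 ->; apply: conv_convex => //; apply: sub_conv; [left|right].
move: x; apply: conv_min.
  move=> _ _ l [m /andP[m0 m1] ->] [n /andP[n0 n1] ->] /andP[l0 l1].
  exists (l * m + (1 - l) * n); first by nra.
  apply/colP => i; rewrite !mxE; ring.
move=> x [->|->]; [exists 1|exists 0]; rewrite ?lexx ?ler01//.
  by rewrite subrr scale0r addr0 scale1r.
by rewrite subr0 scale0r add0r scale1r.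
Qed.

Lemma evQ_comb u (x y : spaceNQ) (l m : rat) :
  evQ u (l *: x + m *: y) = l * evQ u x + m * evQ u y.
Proof. by rewrite !evQE !mxE; ring. Qed.

Lemma areaQ_combr (a x y : spaceNQ) (l m : rat) :
  areaQ a (l *: x + m *: y) = l * areaQ a x + m * areaQ a y.
Proof. by rewrite /areaQ !mxE; ring. Qed.

Lemma convex_evQ u (b : rat) : convexQ [set x | b <= evQ u x].
Proof. by move=> x y l /= hx hy /andP[l0 l1]; rewrite evQ_comb; nra. Qed.

(** * Extreme points of the faces of a polygon *)

(** The rotation of [u] that turns it into a vector along the edges with inner
    normal [u], anticlockwise: pairing with [u] is the determinant with [dir u]. *)
Definition dir (u : latM) : latN := \col_(i < 2) (if i == 0 then u 0 1 else - u 0 0).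

Lemma dirE u : (dir u 0 0 = u 0 1) * (dir u 1 0 = - u 0 0).
Proof. by rewrite !mxE. Qed.

Lemma area_dir u v : area (dir u) v = evN u v.
Proof. by rewrite /area !dirE evNE; ring. Qed.

Lemma dir_norm (u : latM) : u != 0 -> 0 < u 0 0 ^+ 2 + u 0 1 ^+ 2.
Proof.
move=> un0.
have : (u 0 0 != 0) || (u 0 1 != 0).
  rewrite -negb_and; apply: contra un0 => /andP[/eqP a0 /eqP a1].
  by apply/eqP/rowP2; rewrite mxE.
by case/orP => hn; nia.
Qed.

Definition polygon (P : set spaceNQ) : Prop :=
  lattice_polytope P /\ origin_in_interior P.

Lemma fano_polygon P : fano P -> polygon P.
Proof. by case. Qed.

Lemma polygon_convex P : polygon P -> convexQ P.
Proof. by case=> [[S ->] _]; apply: conv_convex. Qed.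

(** The end point of the face with inner normal [u] that comes first ([s = 1]) or
    last ([s = -1]) in anticlockwise order.  A determinant, rather than a second
    linear form, decides the ties: this way the notion is visibly invariant
    under unimodular maps. *)
Definition extreme (P : set spaceNQ) (u : latM) (s : int) (v : latN) : Prop :=
  P (emb v) /\ forall x, P x -> evQ u (emb v) <= evQ u x /\
    (evQ u x = evQ u (emb v) -> 0 <= s%:~R * areaQ (emb v) x).

(** A small negative multiple of [u] lies in the polygon. *)
Lemma min_lt0 P u a : polygon P -> u != 0 ->
  (forall x, P x -> evQ u a <= evQ u x) -> evQ u a < 0.
Proof.
move=> [_ [eps e0 Pe]] un0 amin.
(* The scaling that fits a multiple of [u] into the ball of radius [eps]. *)
pose n : rat := 1 + `|(u 0 0)%:~R| + `|(u 0 1)%:~R|.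
pose c : rat := eps / n.
have a0 := normr_ge0 ((u 0 0)%:~R : rat); have a1 := normr_ge0 ((u 0 1)%:~R : rat).
have n0 : 0 < n by rewrite /n; lra.
have c0 : 0 < c by rewrite divr_gt0.
have cn : c * n = eps by rewrite divfK// gt_eqF.
pose b : spaceNQ := \col_i - (c * (if i == 0 then u 0 0 else u 0 1)%:~R).
have := amin b; rewrite (evQE u b) !mxE /= => h.
have {h}: evQ u a <= - c * (((u 0 0) ^+ 2 + (u 0 1) ^+ 2)%:~R).
  rewrite rmorphD !rmorphXn /=.
  rewrite (_ : - c * _ = (u 0 0)%:~R * - (c * (u 0 0)%:~R) +
     (u 0 1)%:~R * - (c * (u 0 1)%:~R)); last by ring.
  apply: h; apply: Pe => i; rewrite mxE normrN normrM (gtr0_norm c0) -cn ltr_pM2l//.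
  by rewrite /n; case: ifP => _; lra.
by move/le_lt_trans; apply; rewrite mulNr oppr_lt0 mulr_gt0// ltr0z dir_norm.
Qed.

Lemma extreme_lt0 P u s v : polygon P -> u != 0 -> extreme P u s v -> evN u v < 0.
Proof.
move=> pP un0 [_ h]; rewrite -(ltr_int rat) -evQ_emb.
by apply: (min_lt0 pP un0) => x /h[].
Qed.

Lemma extreme_lattice P u s v v' : extreme P u s v -> P (emb v') ->
  evN u v <= evN u v' /\ (evN u v' = evN u v -> 0 <= s * area v v').
Proof.
move=> [_ h] /h; rewrite !evQ_emb area_emb ler_int => -[-> h2]; split=> // e.
by rewrite -(ler_int rat) rmorphM /=; apply: h2; rewrite e.
Qed.

Lemma eq_of_level_area0 (u : latM) (v v' : latN) :
  evN u v != 0 -> evN u v' = evN u v -> area v v' = 0 -> v' = v.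
Proof.
rewrite !evNE /area => un0 e a0; apply: colP2; apply: (mulfI un0).
  by have := congr1 ( *%R (v 0 0)) e; have := congr1 ( *%R (u 0 1)) a0; lia.
by have := congr1 ( *%R (v 1 0)) e; have := congr1 ( *%R (u 0 0)) a0; lia.
Qed.

Lemma extreme_uniq P u s v v' : polygon P -> u != 0 -> s = 1 \/ s = -1 ->
  extreme P u s v -> extreme P u s v' -> v' = v.
Proof.
move=> pP un0 hs ev ev'.
have lt0 := extreme_lt0 pP un0 ev.
have [h1 h2] := extreme_lattice ev (proj1 ev'); have [h3 h4] := extreme_lattice ev' (proj1 ev).
have e : evN u v' = evN u v by apply/eqP; rewrite eq_le h1 h3.
apply: (eq_of_level_area0 _ e); first by rewrite lt_eqF.
move: (h2 e) (h4 (esym e)); rewrite /area; case: hs => ->; lia.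
Qed.

Lemma exists_lexmin (T : eqType) (f g : T -> int) (l : seq T) : l != [::] ->
  exists2 v, v \in l & {in l, forall x, f v < f x \/ (f v = f x /\ g v <= g x)}.
Proof.
elim: l => // a l IH _; case: (eqVneq l [::]) => [->|/IH[v vl h]].
  by exists a; rewrite ?mem_head// => x; rewrite inE => /eqP ->; right.
have [c|c] : (f v < f a \/ (f v = f a /\ g v <= g a)) \/
             (f a < f v \/ (f a = f v /\ g a <= g v)) by lia.
  exists v; rewrite ?inE ?vl ?orbT// => x; rewrite inE => /orP[/eqP->//|].
  exact: h.
exists a; rewrite ?mem_head// => x; rewrite inE => /orP[/eqP->|/h]; first by right.
lia.
Qed.

(** The points that come strictly after [v] for [u], or tie with it and lie on the
    correct side, form a convex set. *)
Lemma extreme_conv (S : seq latN) u s v : v \in S ->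
  {in S, forall x, evN u v < evN u x \/ (evN u v = evN u x /\ 0 <= s * area v x)} ->
  extreme (conv (emb @` [set` S])) u s v.
Proof.
move=> vS h; split; first by apply: sub_conv; exists v.
set a := emb v.
pose C := [set x | evQ u a < evQ u x \/ (evQ u a = evQ u x /\ 0 <= s%:~R * areaQ a x)].
have cvx : convexQ C.
  move=> x y l hx hy /andP[l0 l1]; rewrite /C /= evQ_comb areaQ_combr.
  have [->|ln0] := eqVneq l 0.
    by rewrite subr0 !mul0r !add0r !mul1r.
  have [->|ln1] := eqVneq l 1.
    by rewrite subrr !mul0r !addr0 !mul1r.
  have {ln0}lp : 0 < l by rewrite lt_def ln0.
  have {ln1}l1p : 0 < 1 - l by rewrite subr_gt0 lt_def eq_sym ln1.
  move: hx hy => [hx|[hx hx']] [hy|[hy hy']]; try (by left; nra).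
  by right; split; nra.
move=> x Px; have : C x.
  move: Px; apply: conv_min => // _ [z /= zS <-].
  rewrite /C /= /a !evQ_emb area_emb ltr_int -rmorphM /= ler0z.
  by case: (h z zS) => [|[-> ?]]; [left|right].
by case=> [lt|[-> ?]]; split=> //; [exact: ltW|move=> e; move: lt; rewrite e ltxx].
Qed.

(** On a line where [u] is constant, the determinant with [v] increases with the
    Euclidean product with [dir u]; so minimizing [u] and then that product up
    to sign produces an extreme point. *)
Lemma dir_norm_area (u : latM) (v x : latN) : evN u x = evN u v ->
  (u 0 0 ^+ 2 + u 0 1 ^+ 2) * area v x =
  - evN u v * ((u 0 1 * x 0 0 - u 0 0 * x 1 0) - (u 0 1 * v 0 0 - u 0 0 * v 1 0)).
Proof.
rewrite !evNE /area => e.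
have := congr1 ( *%R (u 0 0 * v 1 0)) e; have := congr1 ( *%R (u 0 1 * v 0 0)) e.
lia.
Qed.

Lemma generators_neq0 (S : seq latN) : polygon (conv (emb @` [set` S])) -> S != [::].
Proof.
case=> _ [e e0 h]; apply/eqP => S0.
have : conv (emb @` [set` S]) 0 by apply: h => i; rewrite mxE normr0.
by move=> P0; have [x [z] /=] := conv_neq0 (ex_intro _ _ P0); rewrite S0.
Qed.

Lemma extreme_ex (S : seq latN) u s : let P := conv (emb @` [set` S]) in polygon P -> u != 0 ->
  s = 1 \/ s = -1 -> exists2 v, v \in S & extreme P u s v.
Proof.
move=> P pP un0 hs.
have [v vS h] := exists_lexmin (evN u)
  (fun x => s * (u 0 1 * x 0 0 - u 0 0 * x 1 0)) (generators_neq0 pP).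
exists v => //.
have lt0 : evN u v < 0.
  rewrite -(ltr_int rat) -evQ_emb; apply: (min_lt0 pP un0).
  apply: conv_min; first exact: convex_evQ.
  by move=> _ [x /= /h hx <-]; rewrite /= !evQ_emb ler_int; lia.
apply: extreme_conv => // x xS; case: (h x xS) => [|[e le]]; first by left.
right; split => //.
rewrite -(pmulr_rge0 _ (dir_norm un0)) mulrCA dir_norm_area// mulrCA.
by apply: mulr_ge0; [lia|rewrite mulrBr subr_ge0].
Qed.

(** A large multiple of [u] perturbed by the determinant with [v] is minimal at [v]
    only. *)
Lemma extreme_vertex P u s v : polygon P -> u != 0 -> s = 1 \/ s = -1 ->
  extreme P u s v -> vertex P v.
Proof.
move=> pP un0 hs ev; have lt0 := extreme_lt0 pP un0 ev.
have [[S PE] _] := pP.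
have SP x : x \in S -> P (emb x) by move=> xS; rewrite PE; apply: sub_conv; exists x.
pose t : latM := \row_(i < 2) (s * if i == 0 then - v 1 0 else v 0 0).
have tE x : evN t x = s * area v x by rewrite evNE !mxE /area /=; ring.
(* The factor by which [u] dominates the perturbation on the generators. *)
have [N N0 hN] : exists2 N : int, 0 < N & {in S, forall x, - N < s * area v x}.
  elim: S {PE SP} => [|a l [N N0 h]]; first by exists 1.
  exists (`|N| + `|s * area v a| + 1); first by lia.
  by move=> x; rewrite inE => /orP[/eqP->|/h]; lia.
have strict x : x \in S -> x != v -> evN (N *: u + t) v < evN (N *: u + t) x.
  move=> xS xv; have [h1 h2] := extreme_lattice ev (SP x xS).
  have ntE y : evN (N *: u + t) y = N * evN u y + s * area v y.
    by rewrite -tE !evNE !mxE; ring.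
  rewrite !ntE (_ : area v v = 0); last by rewrite /area; ring.
  have [e|ne] := eqVneq (evN u x) (evN u v).
    have := h2 e; rewrite e mulr0 addr0 ltrDl lt_def => ->; rewrite andbT.
    apply: contra xv => /eqP z; apply/eqP; apply: (eq_of_level_area0 _ e).
      by rewrite lt_eqF.
    by case: hs z => ->; lia.
  have := hN x xS.
  have : evN u v + 1 <= evN u x by lia.
  nia.
exists (N *: u + t); set u' := _ + t.
pose C := [set x | evQ u' (emb v) < evQ u' x \/ x = emb v].
have PC : P `<=` C.
  rewrite PE; apply: conv_min.
    move=> x y l hx hy /andP[l0 l1]; rewrite /C /= evQ_comb.
    have [->|ln0] := eqVneq l 0.
      by rewrite subr0 !mul0r !add0r !mul1r scale0r add0r scale1r.
    have [->|ln1] := eqVneq l 1.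
      by rewrite subrr !mul0r !addr0 !mul1r scale0r addr0 scale1r.
    have {ln0}lp : 0 < l by rewrite lt_def ln0.
    have {ln1}l1p : 0 < 1 - l by rewrite subr_gt0 lt_def eq_sym ln1.
    move: hx hy => [hx|->] [hy|->]; try (by left; nra).
    by right; rewrite -scalerDl addrC subrK scale1r.
  move=> _ [x /= xS <-]; case: (eqVneq x v) => [->|/(strict x xS) lt]; first by right.
  by left; rewrite !evQ_emb ltr_int.
apply/seteqP; split => x /=.
  move=> [Px /(_ _ (proj1 ev)) le].
  by case: (PC x Px) => // lt; move: (lt_le_trans lt le); rewrite ltxx.
move=> ->; split; first exact: (proj1 ev).
by move=> y /PC [/ltW//|->].
Qed.

(** * Edges *)

Lemma primitive_neq0 u : primitiveM u -> u != 0.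
Proof. by move=> pu; apply/eqP => u0; move: pu; rewrite u0 /primitiveM !mxE. Qed.

Lemma segmentP E x : segment E x <->
  exists2 l : rat, 0 <= l <= 1 & x = l *: emb (source E) + (1 - l) *: emb (target E).
Proof. exact: conv2P. Qed.

(** Unlike an edge, a facet may be reduced to a point. *)
Definition facet (P : set spaceNQ) (E : edge_data) : Prop :=
  [/\ primitiveM (normal E), extreme P (normal E) 1 (source E) &
      extreme P (normal E) (-1) (target E)].

(** In terms of end points, a face is a segment whose ends are extreme: a point of
    the face is the combination of the two ends whose weights are proportional to
    its determinants with them. *)
Lemma is_edgeP P E : polygon P ->
  is_edge P E <-> facet P E /\ 0 < area (source E) (target E).
Proof.
case: E => u [v0 v1] pP; rewrite /is_edge /facet /normal /source /target /=.
rewrite det_two_columns; split.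
  case=> pu fE ar; have un0 := primitive_neq0 pu.
  have arQ : 0 < areaQ (emb v0) (emb v1) by rewrite area_emb ltr0z.
  have f0 : face P u (emb v0).
    rewrite fE; apply/segmentP; exists 1; rewrite ?lexx ?ler01//.
    by rewrite subrr scale0r addr0 scale1r.
  have f1 : face P u (emb v1).
    rewrite fE; apply/segmentP; exists 0; rewrite ?lexx ?ler01//.
    by rewrite subr0 scale0r add0r scale1r.
  have key x : P x -> evQ u x = evQ u (emb v0) ->
      exists2 l : rat, 0 <= l <= 1 & x = l *: emb v0 + (1 - l) *: emb v1.
    move=> Px e; have : face P u x by split=> // y Py; rewrite e; apply: (proj2 f0).
    by rewrite fE => /segmentP.
  have e01 : evQ u (emb v1) = evQ u (emb v0).
    by apply/eqP; rewrite eq_le (proj2 f1 _ (proj1 f0)) (proj2 f0 _ (proj1 f1)).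
  have [[Pv0 _] [Pv1 _]] := (f0, f1).
  split=> //; split=> //; split=> // x Px.
    split; first exact: (proj2 f0).
    move=> e; have [l /andP[l0 l1] ->] := key x Px e.
    rewrite mul1r areaQ_combr (_ : areaQ (emb v0) (emb v0) = 0).
      by rewrite mulr0 add0r; apply: mulr_ge0; [rewrite subr_ge0|exact: ltW].
    by rewrite /areaQ; ring.
  split; first exact: (proj2 f1).
  move=> e; have [l /andP[l0 l1] ->] := key x Px (etrans e e01).
  rewrite areaQ_combr (_ : areaQ (emb v1) (emb v1) = 0); last by rewrite /areaQ; ring.
  rewrite (_ : areaQ (emb v1) (emb v0) = - areaQ (emb v0) (emb v1)); last first.
    by rewrite /areaQ; ring.
  by rewrite rmorphN1 mulr0 addr0 mulrN mulN1r opprK; apply: mulr_ge0 => //; exact: ltW.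
case=> -[pu e0 e1] ar; have un0 := primitive_neq0 pu.
have h0 : evQ u (emb v0) < 0 by rewrite evQ_emb ltrz0; apply: (extreme_lt0 pP un0 e0).
have arQ : 0 < areaQ (emb v0) (emb v1) by rewrite area_emb ltr0z.
split=> //; apply/seteqP.
have e01 : evQ u (emb v1) = evQ u (emb v0).
  apply/eqP; rewrite eq_le (proj1 (proj2 e0 _ (proj1 e1))).
  by rewrite (proj1 (proj2 e1 _ (proj1 e0))).
split=> x /=.
  move=> [Px xmin].
  have ex : evQ u x = evQ u (emb v0).
    by apply/eqP; rewrite eq_le (xmin _ (proj1 e0)) (proj1 (proj2 e0 _ Px)).
  have := proj2 (proj2 e0 _ Px) ex; rewrite mul1r => a0.
  have := proj2 (proj2 e1 _ Px) (etrans ex (esym e01)); rewrite rmorphN1 mulN1r => a1.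
  set D := areaQ (emb v0) (emb v1) in arQ.
  have dec y z : areaQ y z *: x = areaQ x z *: y + areaQ y x *: z.
    by apply: colP2; rewrite !mxE /areaQ; ring.
  have sum1 : areaQ x (emb v1) + areaQ (emb v0) x = D.
    have := congr1 (evQ u) (dec (emb v0) (emb v1)); rewrite -/D evQ_comb e01.
    rewrite -[D *: x]addr0 -(scale0r x) evQ_comb ex mul0r addr0 -mulrDl => h.
    by apply/esym; apply: (mulIf (ltr0_neq0 h0)).
  have a1' : 0 <= areaQ x (emb v1).
    by rewrite (_ : areaQ x (emb v1) = - areaQ (emb v1) x)//; rewrite /areaQ; ring.
  apply/segmentP; exists (areaQ x (emb v1) / D).
    by rewrite divr_ge0 ?(ltW arQ)// ler_pdivrMr// mul1r -sum1 lerDl.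
  rewrite (_ : 1 - _ = areaQ (emb v0) x / D); last first.
    by rewrite -{1}(divff (lt0r_neq0 arQ)) -mulrBl -sum1 addrAC subrr add0r.
  apply: (scalerI (lt0r_neq0 arQ)); rewrite dec scalerDr !scalerA.
  by rewrite ![D * (_ / D)]mulrC !divfK ?lt0r_neq0.
move=> /segmentP /= [l /andP[l0 l1] ->]; split.
  by apply: (polygon_convex pP) (proj1 e0) (proj1 e1) _; rewrite l0.
move=> y Py; rewrite evQ_comb e01 -mulrDl addrC subrK mul1r.
exact: (proj1 (proj2 e0 _ Py)).
Qed.

Lemma facet_eq P E : facet P E -> evN (normal E) (target E) = evN (normal E) (source E).
Proof.
move=> [_ e0 e1]; apply/eqP; rewrite eq_le.
by rewrite (extreme_lattice e0 (proj1 e1)).1 (extreme_lattice e1 (proj1 e0)).1.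
Qed.

Lemma facet_min P E v : facet P E -> P (emb v) ->
  evN (normal E) (source E) <= evN (normal E) v.
Proof. by move=> [_ e0 _] Pv; apply: (extreme_lattice e0 Pv).1. Qed.

Lemma facet_lt0 P E : polygon P -> facet P E -> evN (normal E) (source E) < 0.
Proof. by move=> pP [pu e0 _]; apply: (extreme_lt0 pP (primitive_neq0 pu) e0). Qed.

Lemma facet_inj P E E' : polygon P -> facet P E -> facet P E' ->
  normal E = normal E' -> E = E'.
Proof.
case: E E' => u [v0 v1] [u' [v0' v1']] pP [/= pu e0 e1] [/= _ e0' e1'] eu.
rewrite /normal /source /target /= in pu e0 e1 e0' e1' eu *; subst u'.
have un0 := primitive_neq0 pu.
rewrite (extreme_uniq pP un0 (or_introl erefl) e0 e0').
by rewrite (extreme_uniq pP un0 (or_intror erefl) e1 e1').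
Qed.

Lemma lattice_line u v v' : primitiveM u -> evN u v' = evN u v ->
  exists l : int, v' = v + l *: dir u.
Proof.
rewrite /primitiveM !evNE => pu e.
have [a [b ab]] := Bezoutz (u 0 0) (u 0 1); rewrite pu in ab.
exists (b * (v' 0 0 - v 0 0) - a * (v' 1 0 - v 1 0)).
have h0 := congr1 ( *%R (v' 0 0 - v 0 0)) ab.
have h1 := congr1 ( *%R (v' 1 0 - v 1 0)) ab.
have h2 := congr1 ( *%R a) e.
have h3 := congr1 ( *%R b) e.
by apply: colP2; rewrite !mxE /=; lia.
Qed.

Lemma facet_len P E : polygon P -> facet P E ->
  exists l : nat, target E = source E + l%:Z *: dir (normal E).
Proof.
move=> pP fE; have lt0 := facet_lt0 pP fE; have e := facet_eq fE.
have [pu e0 e1] := fE.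
have [l hl] := lattice_line pu e.
have := (extreme_lattice e0 (proj1 e1)).2 e.
rewrite mul1r (_ : area _ _ = - (l * evN (normal E) (source E))).
  move=> h; have l0 : 0 <= l by nia.
  by exists `|l|%N; rewrite {1}hl gez0_abs.
by rewrite hl /area evNE !mxE /=; ring.
Qed.

(** The condition at [v] excludes opposite vectors. *)
Lemma primitive_collinear (u u' : latM) v : primitiveM u -> primitiveM u' ->
  u 0 0 * u' 0 1 = u 0 1 * u' 0 0 -> evN u v < 0 -> evN u' v < 0 -> u = u'.
Proof.
rewrite /primitiveM !evNE => pu pu' c lt0 lt0'.
have [a [b ab]] := Bezoutz (u 0 0) (u 0 1); rewrite pu in ab.
have [a' [b' ab']] := Bezoutz (u' 0 0) (u' 0 1); rewrite pu' in ab'.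
have [k k0 k1] : exists2 k, u' 0 0 = k * u 0 0 & u' 0 1 = k * u 0 1.
  exists (a * u' 0 0 + b * u' 0 1).
    by have := congr1 ( *%R (u' 0 0)) ab; have := congr1 ( *%R b) c; lia.
  by have := congr1 ( *%R (u' 0 1)) ab; have := congr1 ( *%R a) c; lia.
have kp : 0 < k by rewrite k0 k1 in lt0'; nia.
have [m km] : exists m, k * m = 1.
  by exists (a' * u 0 0 + b' * u 0 1); rewrite k0 k1 in ab'; lia.
have m0 : 0 < m by rewrite -(pmulr_rgt0 _ kp) km.
have kk : k = 1 by clear -kp km m0; nia.
rewrite kk !mul1r in k0 k1.
exact: rowP2.
Qed.

(** Two edges with the same source support each other, so their normals are
    parallel. *)
Lemma edge_source_inj P E E' : polygon P -> is_edge P E -> is_edge P E' ->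
  source E = source E' -> E = E'.
Proof.
move=> pP /(is_edgeP _ pP)[fE aE] /(is_edgeP _ pP)[fE' aE'] es.
apply: (facet_inj pP fE fE').
have [l hl] := facet_len pP fE; have [l' hl'] := facet_len pP fE'.
have lt0 := facet_lt0 pP fE; have lt0' := facet_lt0 pP fE'.
have [pu e0 e1] := fE; have [pu' e0' e1'] := fE'.
have m := facet_min fE (proj1 e1'); have m' := facet_min fE' (proj1 e1).
move: aE aE' m m'; rewrite hl hl' -es; rewrite -es in lt0'.
move: pu pu' lt0 lt0'; rewrite /primitiveM.
set u := normal E; set u' := normal E'; set v := source E => pu pu' lt0 lt0'.
rewrite /area !evNE !mxE /= => aE aE' m m'.
rewrite !evNE in lt0 lt0'.
have l0 : 0 < (l : int) by nia.
have l0' : 0 < (l' : int) by nia.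
have c : u 0 0 * u' 0 1 = u 0 1 * u' 0 0 by nia.
by apply: (primitive_collinear pu pu' c (v := v)); rewrite evNE.
Qed.

(** An edge is determined by its source, which is one of the generators. *)
Lemma edges_finite P : polygon P -> finite_set [set E | is_edge P E].
Proof.
move=> pP; have [[S PE] _] := pP.
pose g v := xget (0, (0, 0)) [set E : edge_data | is_edge P E /\ source E = v].
apply: (@sub_finite_set _ _ (g @` [set` S])); last exact/finite_image/finite_seq.
move=> E /= hE; have [[pu e0 _] _] := proj1 (is_edgeP _ pP) hE.
have un0 := primitive_neq0 pu.
have pP' := pP; rewrite PE in pP'.
have [v vS ev] := extreme_ex pP' un0 (or_introl erefl : (1 : int) = 1 \/ 1 = -1).
rewrite -PE in ev.
exists v => //; rewrite /g.
have sE : source E = v := extreme_uniq pP un0 (or_introl erefl) ev e0.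
have [hG sG] : is_edge P (g v) /\ source (g v) = v.
  apply: (@xgetPex _ (0, (0, 0)) [set E : edge_data | is_edge P E /\ source E = v]).
  by exists E.
by apply: (edge_source_inj pP hG hE); rewrite sG.
Qed.

(** * Lattice length, residues and Hermite forms *)

Lemma edge_length_line (u : latM) (v0 v1 : latN) (l : nat) : primitiveM u ->
  v1 = v0 + l%:Z *: dir u -> edge_length (u, (v0, v1)) = l.
Proof.
move=> pu v1E; set E : edge_data := (u, (v0, v1)); pose pt i : latN := v0 + i%:Z *: dir u.
have un0 := primitive_neq0 pu; have nrm := dir_norm un0.
have pt_inj : injective pt.
  move=> i j /addrI /matrixP h; move: (h 0 0) (h 1 0); rewrite !mxE /= => h0 h1.
  have /eqP : (i%:Z - j%:Z) * (u 0 0 ^+ 2 + u 0 1 ^+ 2) = 0.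
    by have := congr1 ( *%R (u 0 1)) h0; have := congr1 ( *%R (u 0 0)) h1; lia.
  by rewrite mulf_eq0 (gt_eqF nrm) orbF; lia.
pose s := [seq pt i | i <- iota 0 l.+1].
have AE : [set x : latN | segment E (emb x)] = [set` [fset x in s]%fset].
  apply/seteqP; split=> x /=; rewrite !inE.
    move=> /segmentP [c /andP[c0 c1]]; rewrite /source /target /= => ex.
    have e : evN u x = evN u v0.
      apply/eqP; rewrite -(eqr_int rat) -!evQ_emb ex evQ_comb !evQ_emb v1E.
      rewrite (_ : evN u (v0 + _) = evN u v0); last by rewrite !evNE !mxE /=; ring.
      by rewrite -mulrDl addrC subrK mul1r.
    have [j xE] := lattice_line pu e.
    have hj : j%:~R * (dir u 0 0)%:~R = (1 - c) * l%:R * (dir u 0 0)%:~R :> rat.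
      by have /matrixP/(_ 0 0) := ex; rewrite xE v1E !mxE !rmorphD !rmorphM /= => h; lra.
    have hj' : j%:~R * (dir u 1 0)%:~R = (1 - c) * l%:R * (dir u 1 0)%:~R :> rat.
      by have /matrixP/(_ 1 0) := ex; rewrite xE v1E !mxE !rmorphD !rmorphM /= => h; lra.
    have jE : j%:~R = (1 - c) * l%:R :> rat.
      have d : (dir u 0 0 != 0) || (dir u 1 0 != 0).
        rewrite -negb_and !dirE; apply/negP => /andP[/eqP a0 /eqP a1].
        by move: nrm; rewrite a0 (_ : u 0 0 = 0)//; lia.
      by case/orP: d => d; [apply: (mulIf _ hj)|apply: (mulIf _ hj')]; rewrite intr_eq0.
    have j0 : 0 <= j by rewrite -(ler0z rat) jE mulr_ge0// subr_ge0.
    have jl : j <= l%:Z.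
      rewrite -(ler_int rat) jE; have : 0 <= l%:R :> rat by [].
      by rewrite -[l%:Z%:~R]/(l%:R : rat); nra.
    suff : x \in s by []; apply/mapP; exists `|j|%N; last by rewrite xE /pt gez0_abs.
    by rewrite mem_iota; lia.
  move=> xs; have {xs} /mapP[i] : x \in s := xs.
  rewrite mem_iota add0n ltnS => /andP[_ il] ->.
  apply/segmentP; rewrite /source /target /=.
  have [l0|l0] := posnP l.
    have -> : i = 0%N by lia.
    exists 1; rewrite ?ler01 ?lexx// subrr scale0r addr0 scale1r /pt.
    by rewrite scale0r addr0.
  have lQ : 0 < l%:R :> rat by rewrite ltr0n.
  exists (1 - i%:R / l%:R).
    rewrite subr_ge0 ler_pdivrMr// mul1r ler_nat il /= lerBlDr lerDl divr_ge0//.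
  rewrite v1E; apply/colP => k; rewrite !mxE !rmorphD !rmorphM /=.
  rewrite -[i%:~R]/(i%:R : rat) -[l%:~R]/(l%:R : rat).
  by field; rewrite gt_eqF.
rewrite /edge_length AE set_fsetK card_fseq undup_id /s ?size_map ?size_iota//.
by rewrite map_inj_uniq ?iota_uniq.
Qed.

Lemma edge_length_eq E (l : nat) : primitiveM (normal E) ->
  target E = source E + l%:Z *: dir (normal E) -> edge_length E = l.
Proof. by case: E => u [v0 v1]; apply: edge_length_line. Qed.

Lemma hermite_unimodular (B : 'M[int]_2) v0 v1 : B \in unitmx ->
  hermite (B *m v0) (B *m v1) = hermite v0 v1.
Proof.
move=> uB; rewrite /hermite; congr xget; apply/seteqP.
have tE : two_columns (B *m v0) (B *m v1) = B *m two_columns v0 v1.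
  by rewrite /two_columns -mul_mx_row.
split=> H /= [U uU [HE h1 h2 h3]]; rewrite tE in HE *.
  by exists (U *m B); rewrite ?unitmx_mul ?uU// -mulmxA.
exists (U *m invmx B); first by rewrite unitmx_mul uU unitmx_inv.
by split=> //; rewrite HE mulmxA mulmxKV.
Qed.

(** The residue seen from its target, a point that the mutation moves by a single
    shear. *)
Lemma res_hermiteE E (l : nat) : primitiveM (normal E) ->
  target E = source E + l%:Z *: dir (normal E) ->
  res_hermite E = hermite (target E - (res_length E)%:Z *: dir (normal E)) (target E).
Proof.
move=> pu tE; have lE := edge_length_eq pu tE.
rewrite /res_hermite; congr hermite.
rewrite /edge_point /res_length /num_segments lE tE.
set h := edge_height E.
have dv j : divz ((l%:Z *: dir (normal E)) j 0) l%:Z *+ (l %/ h * h)%N =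
    ((l %/ h * h)%N%:Z *: dir (normal E)) j 0.
  rewrite !mxE; have [->|l0] := posnP l; first by rewrite div0n !mul0n mulr0n mul0r.
  rewrite mulrC mulzK ?mulr_natr; last by lia.
  by rewrite mulrC; lia.
have -> : (\col_j divz ((source E + l%:Z *: dir (normal E) - source E) j 0) l%:Z)
    *+ (l %/ h * h)%N = (l %/ h * h)%N%:Z *: dir (normal E) :> latN.
  apply/colP => j; rewrite -dv mulmxnE mxE.
  by rewrite [source E + _]addrC addrK.
rewrite -addrA; congr (_ + _); rewrite -scalerBl; congr (_ *: _).
by have := divn_eq l h; lia.
Qed.

(** * Cyclic sequences *)

Section CyclicSequences.
Variable T : eqType.
Implicit Types (le : rel T) (nx : T -> T) (s t : seq T).

Lemma next_index x0 t x : x \in t ->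
  next t x = nth x0 t (if ((index x t).+1 < size t)%N then (index x t).+1 else 0%N).
Proof.
rewrite next_nth => xt; rewrite xt; case: t xt => // y p _; set i := index _ _.
rewrite [size _]/= ltnS; case: ltnP => h /=; last by rewrite nth_default.
exact: set_nth_default.
Qed.

(** A sorted list is traversed by [nx] once nothing lies between [x] and [nx x],
    where between is meant cyclically: if [nx x] comes before [x], then [x] must
    be the last element and [nx x] the first. *)
Lemma fcycle_pairwise le nx t : uniq t -> pairwise le t -> {in t &, antisymmetric le} ->
  {in t, forall x, nx x \in t} -> {in t, forall x, nx x != x} ->
  {in t &, forall x y, le x (nx x) -> le x y -> le y (nx x) -> y = x \/ y = nx x} ->
  {in t &, forall x y, ~~ le x (nx x) ->
     (le x y -> y = x) /\ (le y (nx x) -> y = nx x)} ->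
  fcycle nx t.
Proof.
move=> ut pw anti nxt nxx btw wrap; apply: cycle_from_next => // x xt /=.
apply/eqP; rewrite (next_index x xt).
have nt := nxt x xt.
set i := index x t; set j := index (nx x) t.
have it : (i < size t)%N by rewrite index_mem.
have jt : (j < size t)%N by rewrite index_mem.
have xE : nth x t i = x by rewrite nth_index.
have nxE : nth x t j = nx x by rewrite nth_index.
have leP k m : (k < size t)%N -> (m < size t)%N -> (k < m)%N -> le (nth x t k) (nth x t m).
  by move/pairwiseP: pw => /(_ x) pw kt mt; apply: pw.
have inj k m : (k < size t)%N -> (m < size t)%N -> nth x t k = nth x t m -> k = m.
  by move=> kt mt /eqP; rewrite nth_uniq// => /eqP.
have ij : i <> j by move=> e; have := nxx x xt; rewrite -nxE -e xE eqxx.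
have nle : (j < i)%N -> ~~ le x (nx x).
  move=> ji; apply/negP => l; have := leP _ _ jt it ji; rewrite xE nxE => l'.
  by move/eqP: (nxx x xt); apply; apply: anti => //; rewrite l l'.
have [i1|i1] := ltnP i.+1 (size t).
  have yt := mem_nth x i1; set y := nth x t i.+1 in yt *.
  have lxy : le x y by rewrite -{1}xE; apply: leP.
  have ynx : y <> x by rewrite -xE => /inj e; have := e i1 it; lia.
  have {ij} [ji|ji] : (j < i \/ i < j)%N by lia.
    by case: (wrap x y xt yt (nle ji)) => /(_ lxy).
  have lxn : le x (nx x) by rewrite -{1}xE -nxE; apply: leP.
  case: (ltngtP i.+1 j) => [ij1| |e]; [|by lia|by rewrite -nxE /y e].
  have := leP _ _ i1 jt ij1; rewrite nxE -/y => lyn.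
  by case: (btw x y xt yt lxn lxy lyn).
have ji : (j < i)%N by lia.
have t0 : (0 < size t)%N by lia.
have [j0|j0] := posnP j; first by rewrite -nxE j0.
have := leP _ _ t0 jt j0; rewrite nxE => l.
by have [_ /(_ l)] := wrap _ _ xt (mem_nth x t0) (nle ji).
Qed.

Lemma fcycle_rot nx s t : uniq s -> uniq t -> s =i t ->
  fcycle nx s -> fcycle nx t -> exists k, t = rot k s.
Proof.
move=> us ut st; case: t ut st => [|y t] ut st cs ct.
  by exists 0%N; case: s st {us cs} => // a s /(_ a); rewrite inE eqxx.
have ys : y \in s by rewrite st mem_head.
have [k s' e] := rot_to ys.
exists k; rewrite e; congr cons.
have sz : size s' = size t.
  have : perm_eq (rot k s) (y :: t).
    by apply: uniq_perm; rewrite ?rot_uniq// => z; rewrite mem_rot st.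
  by move/perm_size; rewrite e => -[].
move: cs; rewrite -(rot_cycle k) e /= => cs.
move/fpathP: cs => [n hn]; move/fpathP: ct => [m hm].
have hs := congr1 size hn; have ht := congr1 size hm.
rewrite !size_rcons !size_traject sz in hs ht.
by move: hm; rewrite -ht hs -hn => /rcons_inj [].
Qed.

Lemma filter_rot (a : pred T) k s : exists m, filter a (rot k s) = rot m (filter a s).
Proof.
exists (size (filter a (take k s))).
have -> : filter a s = filter a (take k s) ++ filter a (drop k s).
  by rewrite -filter_cat cat_take_drop.
by rewrite /rot filter_cat take_size_cat// drop_size_cat.
Qed.

End CyclicSequences.

(** * The cyclic order of the edges *)

Lemma edge_facts P E : polygon P -> is_edge P E ->
  [/\ facet P E, primitiveM (normal E), evN (normal E) (source E) < 0 &
   exists2 l : nat, (0 < l)%N & target E = source E + l%:Z *: dir (normal E)].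
Proof.
move=> pP /(is_edgeP _ pP)[fE ar]; have lt0 := facet_lt0 pP fE.
have [pu _ _] := fE.
split=> //; have [l hl] := facet_len pP fE; exists l => //.
case: posnP => // l0; move: ar; rewrite hl l0 scale0r addr0 /area; lia.
Qed.

(** A source [v] inside the cone over an edge lies in the triangle spanned by the
    edge and the origin.  The normal of the edge that starts at [v] is minimal,
    and negative, at [v], which forces [v] and both ends of the first edge into
    the same face; then [v] is not the first point of that face. *)
Lemma no_source_in_cone P E E' : polygon P -> is_edge P E -> is_edge P E' ->
  0 < area (source E) (source E') -> 0 < area (source E') (target E) -> False.
Proof.
move=> pP eE eE'.
have [fE pu lt0 _] := edge_facts pP eE; have [fE' pu' lt0' _] := edge_facts pP eE'.
have eq := facet_eq fE; have [_ ar] := proj1 (is_edgeP _ pP) eE.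
have [_ [P0 _] [P1 _]] := fE; have [_ x' _] := fE'.
have [Pv' _] := x'.
have h := facet_min fE Pv'; have h0 := facet_min fE' P0; have h1 := facet_min fE' P1.
have [_ h2] := extreme_lattice x' P0.
move: (normal E) (normal E') (source E) (target E) (source E') ar eq lt0 lt0' h h0 h1 h2.
move=> u u' v0 v1 v ar eq lt0 lt0' h h0 h1 h2 a0 a1; have ab := a0.
have dec (t : latM) : area v0 v1 * evN t v = area v v1 * evN t v0 + area v0 v * evN t v1.
  by rewrite !evNE /area; ring.
have d1 := dec u; have d2 := dec u'.
rewrite eq -mulrDl in d1.
move: (area v0 v1) (area v v1) (area v0 v) d1 d2 ar a0 a1 => D a b d1 d2 ar b0 a0.
have s1 : a + b <= D.
  by rewrite -(ler_nM2r lt0) -d1 ler_pM2l.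
have e0 : evN u' v0 = evN u' v.
  apply/eqP; rewrite eq_le h0 andbT leNgt; apply/negP => lt.
  have k1 : a * evN u' v < a * evN u' v0 by rewrite ltr_pM2l.
  have k2 : b * evN u' v <= b * evN u' v1 by rewrite ler_pM2l.
  have k3 : D * evN u' v <= (a + b) * evN u' v by rewrite ler_nM2r.
  lia.
by have := h2 e0; move: ab; rewrite /area; lia.
Qed.

(** Within an open half-plane the sign of the determinant is a total preorder. *)
Lemma exists_min_angle (e v : latN) (l : seq latN) : l != [::] ->
  {in l, forall x, 0 < area e (x - v)} ->
  exists2 m, m \in l & {in l, forall x, 0 <= area (m - v) (x - v)}.
Proof.
elim: l => // a l IH _ pos; case: (eqVneq l [::]) => [->|/IH].
  by exists a; rewrite ?mem_head// => x; rewrite inE => /eqP ->; rewrite areaxx.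
case=> [x xl|m ml hm]; first by apply: pos; rewrite inE xl orbT.
have [c|c] := leP 0 (area (m - v) (a - v)).
  by exists m; rewrite ?inE ?ml ?orbT// => x; rewrite inE => /orP[/eqP->//|/hm].
exists a; rewrite ?mem_head// => x; rewrite inE => /orP[/eqP->|xl].
  by rewrite areaxx.
have pm : 0 < area e (m - v) by apply: pos; rewrite inE ml orbT.
have pa : 0 < area e (a - v) by apply: pos; rewrite mem_head.
have px : 0 < area e (x - v) by apply: pos; rewrite inE xl orbT.
rewrite -(pmulr_rge0 _ pm).
have -> : area e (m - v) * area (a - v) (x - v) =
  area e (a - v) * area (m - v) (x - v) + area e (x - v) * - area (m - v) (a - v).
  by rewrite /area; ring.
by apply: addr_ge0; apply: mulr_ge0; rewrite ?(ltW pa) ?(ltW px) ?oppr_ge0 ?(ltW c) ?hm.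
Qed.

Lemma primitive_normal (d : latN) : d != 0 ->
  exists2 g : int, 0 < g & exists2 u : latM, primitiveM u & forall x, g * evN u x = area d x.
Proof.
move=> d0; pose g := gcdz (d 0 0) (d 1 0).
have g0 : 0 < g.
  rewrite lt_def; apply/andP; split; last by [].
  rewrite gcdz_eq0; apply: contra d0 => /andP[/eqP h0 /eqP h1].
  by apply/eqP/colP2; rewrite mxE.
have [/dvdzP[a ha] /dvdzP[b hb]] : (g %| d 0%R 0%R)%Z /\ (g %| d 1%R 0%R)%Z.
  by rewrite dvdz_gcdl dvdz_gcdr.
exists g => //; exists (\row_(i < 2) if i == 0 then - b else a).
  rewrite /primitiveM !mxE /=; have [m [n mn]] := Bezoutz (d 0 0) (d 1 0).
  rewrite -/g ha hb in mn.
  have e1 : (- n) * (- b) + m * a = 1.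
    by apply: (mulIf (lt0r_neq0 g0)); rewrite mul1r -[RHS]mn; ring.
  have : (gcdz (- b)%R a %| ((- n) * (- b) + m * a)%R)%Z.
    by rewrite rpredD// dvdz_mull// ?dvdz_gcdl ?dvdz_gcdr.
  rewrite e1.
  by rewrite dvdz1 => /eqP; have : 0 <= gcdz (- b) a by []; lia.
move=> x; rewrite evNE !mxE /= /area ha hb; ring.
Qed.

Lemma area_collinear (u : latM) (v x d : latN) : area d (x - v) = 0 ->
  evN u d * area v x = (evN u x - evN u v) * area v d.
Proof.
rewrite areaBr /area !evNE => a0.
by have := congr1 ( *%R (u 0 0 * v 0 0 + u 0 1 * v 1 0)) a0; lia.
Qed.

(** Rotating the supporting line about the target of [E] until it meets the polygon
    again gives the next edge: among the generators strictly above [E], take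
    one that is seen from the target under the least angle. *)
Lemma next_edge_ex P E : polygon P -> is_edge P E ->
  exists2 E', is_edge P E' & source E' = target E.
Proof.
move=> pP eE; have [fE pu lt0 [l l0 hl]] := edge_facts pP eE.
have [[S PE] Pint] := pP; have pP' := pP; rewrite PE in pP'.
have un0 := primitive_neq0 pu.
have [v vS ev] := extreme_ex pP' un0 (or_intror erefl : (-1 : int) = 1 \/ -1 = -1).
rewrite -PE in ev; have [_ _ e1] := fE.
have vE := extreme_uniq pP un0 (or_intror erefl) ev e1.
rewrite -(facet_eq fE) vE in lt0; rewrite vE.
move: (normal E) (source E) pu lt0 hl un0 ev {fE e1 vE eE} => u v0 pu lt0 hl un0 ev.
have SP x : x \in S -> P (emb x) by move=> xS; rewrite PE; apply: sub_conv; exists x.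
pose up := [seq x <- S | evN u v < evN u x].
have up0 : up != [::].
  apply/negP => /eqP up0.
  have h : P `<=` [set x | - evQ u (emb v) <= evQ (- u) x].
    rewrite PE; apply: conv_min; first exact: convex_evQ.
    move=> _ [x /= xS <-]; rewrite !evQ_emb -rmorphN /= ler_int.
    have -> : evN (- u) x = - evN u x by rewrite !evNE !mxE; ring.
    rewrite lerN2 leNgt; apply/negP => lt.
    have xup : x \in up by rewrite mem_filter lt.
    by rewrite up0 in xup.
  have P0 : P 0 by case: Pint => eps eps0; apply=> i; rewrite mxE normr0.
  have := h 0 P0; rewrite /= (evQE _ 0) !mxE !mulr0 addr0 evQ_emb -rmorphN /= lerz0; lia.
have uE x : area (dir u) (x - v) = evN u x - evN u v by rewrite area_dir !evNE !mxE; ring.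
have [|m mup hm] := exists_min_angle (e := dir u) (v := v) up0.
  by move=> x; rewrite mem_filter uE => /andP[lt _]; rewrite subr_gt0.
move: mup; rewrite mem_filter => /andP[mlt mS].
pose d := m - v.
have dS x : x \in S -> 0 <= area d (x - v).
  move=> xS; have [g1 g2] := extreme_lattice ev (SP x xS).
  have [lt|le] := ltP (evN u v) (evN u x); first by apply: hm; rewrite mem_filter lt.
  have e : evN u x = evN u v by lia.
  have [k xE] := lattice_line pu e; have := g2 e.
  have -> : area v x = - (k * evN u v) by rewrite xE /area !evNE !mxE /=; ring.
  have -> : area d (x - v) = - (k * (evN u m - evN u v)).
    by rewrite -uE xE /d /area !mxE /=; ring.
  nia.
have dn0 : d != 0 by apply/eqP => dz; move: mlt; rewrite (subr0_eq dz) ltxx.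
have [g g0 [u' pu' hu']] := primitive_normal dn0.
have un0' := primitive_neq0 pu'.
have min' x : x \in S -> evN u' v <= evN u' x.
  move=> xS; rewrite -(ler_pM2l g0) !hu'; have := dS x xS; rewrite areaBr; lia.
have lt' : evN u' v < 0.
  rewrite -(ltr_int rat) -evQ_emb; apply: (min_lt0 pP un0').
  rewrite PE; apply: conv_min; first exact: convex_evQ.
  by move=> _ [x /= /min' hx <-]; rewrite /= !evQ_emb ler_int.
have avd : 0 < area v d by have := hu' v; rewrite /area; nia.
have e0' : extreme P u' 1 v.
  rewrite PE; apply: extreme_conv => //.
  move=> x xS; have := min' x xS; rewrite le_eqVlt => /orP[/eqP e|]; last by left.
  right; split=> //; rewrite mul1r.
  have a0 : area d (x - v) = 0.
    by rewrite areaBr -!hu' e subrr.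
  have ud : 0 < evN u (m - v) by rewrite evNB subr_gt0.
  rewrite -(pmulr_rge0 _ ud).
  rewrite (area_collinear _ a0).
  apply: mulr_ge0; last exact: ltW.
  by rewrite subr_ge0 (extreme_lattice ev (SP x xS)).1.
have [v2 _ e1'] := extreme_ex pP' un0' (or_intror erefl : (-1 : int) = 1 \/ -1 = -1).
rewrite -PE in e1'.
have f' : facet P (u', (v, v2)) by split.
exists (u', (v, v2)) => //; apply/is_edgeP => //; split=> //.
have [l' hl'] := facet_len pP f'.
rewrite /source /target /normal /= in hl' *.
have l'0 : (0 < l')%N.
  case: posnP => // l'0; move: hl'; rewrite l'0 scale0r addr0 => v2E; subst v2.
  have [_ h] := extreme_lattice e1' (SP m mS).
  have : evN u' m = evN u' v.
    by apply: (mulfI (lt0r_neq0 g0)); rewrite !hu' -(subrK v m) -/d; rewrite /area !mxE; ring.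
  by move/h; move: avd; rewrite /d areaBr areaxx; lia.
have -> : area v v2 = l'%:Z * - evN u' v by rewrite hl' /area evNE !mxE /=; ring.
by rewrite mulr_gt0 ?oppr_gt0// ltz_nat.
Qed.

(** The normals turn strictly to the left from an edge to the next one. *)
Lemma cross_next P E E' : polygon P -> is_edge P E -> is_edge P E' ->
  source E' = target E ->
  0 < normal E 0 0 * normal E' 0 1 - normal E 0 1 * normal E' 0 0.
Proof.
move=> pP eE eE' st.
have [fE pu lt0 [l l0 hl]] := edge_facts pP eE.
have [fE' pu' lt0' [l' l0' hl']] := edge_facts pP eE'.
have [_ _ [P2 _]] := fE'; have := facet_min fE P2; rewrite hl' st -(facet_eq fE).
rewrite -(facet_eq fE) in lt0; rewrite st in lt0'.
have ne : normal E <> normal E'.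
  move=> e; have := facet_inj pP fE fE' e => EE'; move: st; rewrite -EE' hl => /esym/eqP.
  rewrite -subr_eq0 addrC addKr => /eqP/matrixP h.
  have := dir_norm (primitive_neq0 pu); have := h 0 0; have := h 1 0.
  by rewrite !mxE /=; move: (normal E : latM) => u; nia.
move: pu pu' lt0 lt0' ne; rewrite !evNE !mxE /=.
move: (normal E : latM) (normal E' : latM) (target E) => u u' v pu pu' lt0 lt0' ne h.
rewrite lt_def; apply/andP; split; last by nia.
apply/negP => /eqP c; apply: ne.
by apply: (primitive_collinear (v := v) pu pu'); rewrite ?evNE//; lia.
Qed.

(** * The order by polar angle *)

Definition next_edge P E := xget E [set E' | is_edge P E' /\ source E' = target E].

Lemma next_edgeP P E : polygon P -> is_edge P E ->
  is_edge P (next_edge P E) /\ source (next_edge P E) = target E.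
Proof.
move=> pP eE; have [E' eE' sE'] := next_edge_ex pP eE.
by apply: (@xgetPex _ E [set E' | is_edge P E' /\ source E' = target E]); exists E'.
Qed.

Lemma next_edge_neq P E : polygon P -> is_edge P E -> next_edge P E != E.
Proof.
move=> pP eE; have [_ s] := next_edgeP pP eE.
apply/eqP => e; rewrite e in s; have [_ ar] := proj1 (is_edgeP _ pP) eE.
by rewrite -s areaxx in ar.
Qed.

(** The vectors with polar angle in [0, pi); those in [pi, 2 pi) are their
    opposites. *)
Definition upper (v : latN) : Prop := 0 < v 1 0 \/ (v 1 0 = 0 /\ 0 < v 0 0).

Lemma upperP (v : latN) : v != 0 ->
  (lower_half v = false /\ upper v) \/ (lower_half v = true /\ upper (- v)).
Proof.
move=> v0; rewrite /upper /lower_half !latNE.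
have : ~ (v 0 0 = 0 /\ v 1 0 = 0).
  by move=> [h0 h1]; move/eqP: v0; apply; apply: colP2; rewrite mxE.
case: (ltrgtP (v 1 0) 0) => h1; case: (ltrgtP (v 0 0) 0) => h0 h /=;
  (try by case: h); (try by left; split=> //; lia); by right; split=> //; lia.
Qed.

Lemma upper_trans a b c : upper a -> upper b -> upper c ->
  0 <= area a b -> 0 <= area b c -> 0 <= area a c.
Proof.
rewrite /upper /area => ha hb hc hab hbc.
have [b0|[b0 b0']] := hb; last first.
  rewrite b0 in hab hbc.
  have a1 : a 1 0 = 0 by nia.
  by rewrite a1; nia.
rewrite -(pmulr_rge0 _ b0).
have -> : b 1 0 * (a 0 0 * c 1 0 - c 0 0 * a 1 0) =
  a 1 0 * (b 0 0 * c 1 0 - c 0 0 * b 1 0) + c 1 0 * (a 0 0 * b 1 0 - b 0 0 * a 1 0).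
  by ring.
by apply: addr_ge0; apply: mulr_ge0 => //; lia.
Qed.

Lemma areaNN (v v' : latN) : area (- v) (- v') = area v v'.
Proof. by rewrite /area !mxE; ring. Qed.

Lemma areaC v v' : area v' v = - area v v'.
Proof. by rewrite /area; ring. Qed.

Lemma angle_le_trans : {in [pred v : latN | v != 0] & &, transitive angle_le}.
Proof.
move=> b a c; rewrite !inE => b0 a0 c0; rewrite /angle_le !det_two_columns.
have [[-> ha]|[-> ha]] := upperP a0; have [[-> hb]|[-> hb]] := upperP b0;
  have [[-> hc]|[-> hc]] := upperP c0; rewrite //=.
  exact: upper_trans.
by move=> h1 h2; rewrite -areaNN; apply: upper_trans ha hb hc _ _; rewrite areaNN.
Qed.

Lemma angle_le_total : total angle_le.
Proof.
move=> a b; rewrite /angle_le !det_two_columns (areaC a b).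
by case: (lower_half a); case: (lower_half b); rewrite //=; case: lerP => //; lia.
Qed.

Lemma upper_before (a v b : latN) : upper a -> upper v -> upper (- b) ->
  0 < area a b -> 0 < area a v -> 0 < area v b.
Proof.
rewrite /upper !latNE => ha hv hb ab av.
have e : a 1 0 * area v b = v 1 0 * area a b + - b 1 0 * area a v by rewrite /area; ring.
have [a1|a1] : 0 < a 1 0 \/ a 1 0 = 0 by lia.
  rewrite -(pmulr_rgt0 _ a1) e.
  have [v1|v1] : 0 < v 1 0 \/ v 1 0 = 0 by lia.
    apply: ltr_wpDr; last exact: mulr_gt0.
    by apply: mulr_ge0; lia.
  have v0 : 0 < v 0 0 by lia.
  by have := mulr_gt0 v0 a1; move: av; rewrite /area v1; lia.
have a0 : 0 < a 0 0 by lia.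
move: ab av; rewrite /area a1 !mulr0 !subr0 !pmulr_rgt0//; lia.
Qed.

Lemma upper_after (a v b : latN) : upper a -> upper (- v) -> upper (- b) ->
  0 < area a b -> 0 < area v b -> 0 < area a v.
Proof.
rewrite /upper !latNE => ha hv hb ab vb.
have e : - b 1 0 * area a v = - v 1 0 * area a b + a 1 0 * area v b by rewrite /area; ring.
have [b1|b1] : 0 < - b 1 0 \/ b 1 0 = 0 by lia.
  rewrite -(pmulr_rgt0 _ b1) e.
  have [a1|a1] : 0 < a 1 0 \/ a 1 0 = 0 by lia.
    apply: ltr_wpDl; last exact: mulr_gt0.
    by apply: mulr_ge0; lia.
  have a0 : 0 < a 0 0 by lia.
  by move: ab; rewrite /area a1 mulr0 subr0 pmulr_rgt0//; lia.
have b0 : b 0 0 < 0 by lia.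
by move: vb; rewrite /area b1 mulr0 add0r -mulNr pmulr_rgt0; lia.
Qed.

(** A vector in angular order between the two ends of a cone is in the interior of
    the cone or on one of its two sides. *)
Lemma angle_between (a v b : latN) : a != 0 -> v != 0 -> b != 0 -> 0 < area a b ->
  angle_le a b -> angle_le a v -> angle_le v b ->
  (0 < area a v /\ 0 < area v b) \/ (angle_le a v /\ angle_le v a) \/
  (angle_le v b /\ angle_le b v).
Proof.
move=> a0 v0 b0; rewrite /angle_le !det_two_columns (areaC a v) (areaC v b).
have [[-> ha]|[-> ha]] := upperP a0; have [[-> hv]|[-> hv]] := upperP v0;
  have [[-> hb]|[-> hb]] := upperP b0; rewrite //=; try lia.
- move=> ab _ av _.
  have [h|h] : (area a v = 0 \/ 0 < area a v) by lia.
    by right; left; rewrite h; lia.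
  by left; split=> //; apply: upper_before ha hv hb ab h.
- move=> ab _ _ vb.
  have [h|h] : (area v b = 0 \/ 0 < area v b) by lia.
    by right; right; rewrite h; lia.
  by left; split=> //; apply: upper_after ha hv hb ab h.
Qed.

(** The same when the cone contains the ray from which angles are measured. *)
Lemma angle_wrap (a v b : latN) : a != 0 -> v != 0 -> b != 0 -> 0 < area a b ->
  ~~ angle_le a b ->
  (angle_le a v -> (0 < area a v /\ 0 < area v b) \/ angle_le v a) /\
  (angle_le v b -> (0 < area a v /\ 0 < area v b) \/ angle_le b v).
Proof.
move=> a0 v0 b0; rewrite /angle_le !det_two_columns (areaC a v) (areaC v b).
have [[-> ha]|[-> ha]] := upperP a0; have [[-> hv]|[-> hv]] := upperP v0;
  have [[-> hb]|[-> hb]] := upperP b0; rewrite //=; try lia.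
- move=> ab _; split=> //= vb.
  have [h|h] : (area v b = 0 \/ 0 < area v b) by lia.
    by right; lia.
  left; split=> //; rewrite -areaNN; apply: (upper_after (b := - b)) => //;
    by rewrite ?opprK ?areaNN.
- move=> ab _; split=> //= av.
  have [h|h] : (area a v = 0 \/ 0 < area a v) by lia.
    by right; lia.
  left; split=> //; rewrite -areaNN; apply: (upper_before (a := - a)) => //;
    by rewrite ?opprK ?areaNN.
Qed.

Lemma source_neq0 P E : polygon P -> is_edge P E -> source E != 0.
Proof.
move=> pP eE; apply/eqP => e; have [_ ar] := proj1 (is_edgeP _ pP) eE.
by move: ar; rewrite e /area !mxE; lia.
Qed.

(** Sources on a common ray coincide: each is minimal for its own normal, so none
    can be the longer one. *)
Lemma angle_anti P E E' : polygon P -> is_edge P E -> is_edge P E' ->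
  angle_le (source E) (source E') -> angle_le (source E') (source E) -> E = E'.
Proof.
move=> pP eE eE' le1 le2; apply: (edge_source_inj pP eE eE').
have v0 := source_neq0 pP eE; have v0' := source_neq0 pP eE'.
have [fE _ lt0 _] := edge_facts pP eE; have [fE' _ lt0' _] := edge_facts pP eE'.
have [_ [P0 _] _] := fE; have [_ [P0' _] _] := fE'.
have h := facet_min fE P0'; have h' := facet_min fE' P0.
move: (source E : latN) (source E' : latN) (normal E) (normal E') v0 v0' lt0 lt0' h h' le1 le2.
move=> v v' u u' v0 v0' lt0 lt0' h h' le1 le2.
have [a0 sg] : area v v' = 0 /\ ((upper v /\ upper v') \/ (upper (- v) /\ upper (- v'))).
  move: le1 le2; rewrite /angle_le !det_two_columns (areaC v v').
  have [[-> hv]|[-> hv]] := upperP v0; have [[-> hv']|[-> hv']] := upperP v0';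
  rewrite //= => l1 l2; (split; first by lia); tauto.
have prop (t t' : latM) : evN t v * evN t' v' = evN t v' * evN t' v.
  have -> : evN t v * evN t' v' = evN t v' * evN t' v +
      (t 0 0 * t' 0 1 - t 0 1 * t' 0 0) * area v v' by rewrite /area !evNE; ring.
  by rewrite a0 mulr0 addr0.
have neg : evN u v' < 0.
  rewrite ltNge; apply/negP => ge0.
  have pX := prop u (\row_i (if i == 0 then 1 else 0)).
  have pY := prop u (\row_i (if i == 0 then 0 else 1)).
  move: pX pY; rewrite ![evN (\row_i _) _]evNE !mxE /= !mul1r !mul0r !add0r !addr0 => pX pY.
  have pp : 0 < evN u v'.
    rewrite lt_def ge0 andbT; apply/eqP => z; have := prop u u'; rewrite z mul0r.
    by move=> /eqP; rewrite mulf_eq0 !lt_eqF.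
  have sY : forall y y' : int, 0 <= y -> 0 <= y' -> evN u v * y' = evN u v' * y ->
      y = 0 /\ y' = 0 by clear -pp lt0; move=> *; split; nia.
  move: sg; rewrite /upper !latNE => -[[h1 h2]|[h1 h2]].
    have [y0 y0'] : v 1 0 = 0 /\ v' 1 0 = 0 by apply: sY => //; lia.
    have [] : v 0 0 = 0 /\ v' 0 0 = 0 by apply: sY => //; lia.
    lia.
  have [y0 y0'] : - v 1 0 = 0 /\ - v' 1 0 = 0 by apply: sY; lia.
  have [] : - v 0 0 = 0 /\ - v' 0 0 = 0 by apply: sY; lia.
  lia.
apply/esym/(@eq_of_level_area0 u) => //; first by rewrite lt_eqF.
have := prop u u'; nia.
Qed.

Lemma mem_edges P E : polygon P -> (E \in edges P) = `[< is_edge P E >].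
Proof.
move=> pP; rewrite /edges mem_sort in_fset_set; last exact: edges_finite.
by apply/idP/asboolP => [/set_mem|h]; last apply/mem_set.
Qed.

Lemma edges_uniq P : uniq (edges P).
Proof. by rewrite sort_uniq fset_uniq. Qed.

Lemma edges_fcycle P : polygon P -> fcycle (next_edge P) (edges P).
Proof.
move=> pP.
have isE E : E \in edges P -> is_edge P E by rewrite mem_edges// => /asboolP.
apply: (@fcycle_pairwise _ (fun E E' => angle_le (source E) (source E'))).
- exact: edges_uniq.
- rewrite -(@sorted_pairwise_in _ (mem (edges P))).
  + by apply: sort_sorted => E E'; apply: angle_le_total.
  + move=> E' E E'' h' h h''; apply: angle_le_trans;
      by rewrite inE; apply: source_neq0 pP (isE _ _).
  + by apply/allP.
- by move=> E E' /isE h /isE h' /andP[]; apply: angle_anti pP h h'.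
- by move=> E /isE h; rewrite mem_edges//; apply/asboolP; case: (next_edgeP pP h).
- by move=> E /isE; apply: next_edge_neq.
- move=> E E' /isE h /isE h'; have [hn sn] := next_edgeP pP h.
  have [_ ar] := proj1 (is_edgeP _ pP) h; rewrite -sn in ar.
  move=> l1 l2 l3; have := angle_between (source_neq0 pP h) (source_neq0 pP h')
    (source_neq0 pP hn) ar l1 l2 l3.
  case=> [[c1]|[[c1 c2]|[c1 c2]]].
  + by rewrite sn => /(no_source_in_cone pP h h' c1).
  + by left; apply: angle_anti pP h' h c2 c1.
  + by right; apply: angle_anti pP h' hn c1 c2.
- move=> E E' /isE h /isE h'; have [hn sn] := next_edgeP pP h.
  have [_ ar] := proj1 (is_edgeP _ pP) h; rewrite -sn in ar.
  move=> nl; have [w1 w2] := angle_wrap (source_neq0 pP h) (source_neq0 pP h')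
    (source_neq0 pP hn) ar nl.
  split=> l; [case: (w1 l)|case: (w2 l)].
  + by case=> c1; rewrite sn => /(no_source_in_cone pP h h' c1).
  + by move=> c; apply: angle_anti pP h' h c l.
  + by case=> c1; rewrite sn => /(no_source_in_cone pP h h' c1).
  + by move=> c; apply: angle_anti pP h' hn l c.
Qed.

(** * The order by height *)

Definition dotM (u w : latM) : int := u 0 0 * w 0 0 + u 0 1 * w 0 1.

(** With [w] pointing up, [dir w] points to the right, so that the face with inner
    normal [u] is on the left when [evN u (dir w)] is positive and on the right
    when it is negative; horizontal faces are told apart by the product with
    [w].  The values follow the boundary anticlockwise. *)
Definition side (w u : latM) : nat :=
  if 0 < evN u (dir w) then 0%N else if evN u (dir w) < 0 then 2%N
  else if 0 < dotM u w then 1%N else 3%N.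

Definition descent (w : latM) (E : edge_data) : int :=
  if 0 < evN (normal E) (dir w) then - evN w (source E)
  else if evN (normal E) (dir w) < 0 then evN w (source E) else 0.

(** An order that mutations preserve, as they preserve heights; it lists the edges
    anticlockwise from the top of the left side. *)
Definition height_le (w : latM) (E E' : edge_data) : bool :=
  (side w (normal E) < side w (normal E'))%N ||
  (side w (normal E) == side w (normal E')) && (descent w E <= descent w E').

Lemma height_le_total w : total (height_le w).
Proof. by move=> E E'; rewrite /height_le; lia. Qed.

Lemma height_le_trans w : transitive (height_le w).
Proof. by move=> E E' E''; rewrite /height_le; lia. Qed.

Lemma evN_dirC u w : evN w (dir u) = - evN u (dir w).
Proof. by rewrite !evNE !dirE; ring. Qed.

(** The linear relation between three vectors of a plane. *)
Lemma evN_plucker (u u' w : latM) (d : latN) :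
  evN u (dir w) * evN u' d - evN u' (dir w) * evN u d = evN u' (dir u) * - evN w d.
Proof. by rewrite !evNE !dirE; ring. Qed.

Lemma evN_addZ u (v v' : latN) l : evN u (v + l *: v') = evN u v + l * evN u v'.
Proof. by rewrite !evNE !latNE; ring. Qed.

Lemma evN_dir u : evN u (dir u) = 0.
Proof. by rewrite !evNE !dirE; ring. Qed.

Lemma horizontal_normal w u : primitiveM w -> primitiveM u -> evN u (dir w) = 0 ->
  (0 < dotM u w -> u = w) /\ (dotM u w <= 0 -> u = - w).
Proof.
move=> pw pu; rewrite evNE !dirE => h0.
have nw := dir_norm (primitive_neq0 pw); have nu := dir_norm (primitive_neq0 pu).
pose v : latN := \col_(i < 2) (if i == 0 then w 0 0 else w 0 1).
have vE : (v 0 0 = w 0 0) * (v 1 0 = w 0 1) by rewrite !mxE.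
have dn : dotM u w ^+ 2 = (u 0 0 ^+ 2 + u 0 1 ^+ 2) * (w 0 0 ^+ 2 + w 0 1 ^+ 2).
  by have := congr1 (fun x => x * x) h0; rewrite /dotM; lia.
split=> d.
  apply: (primitive_collinear (v := - v) pu pw); first by lia.
    by move: d; rewrite /dotM evNE !latNE !vE; lia.
  by move: nw; rewrite evNE !latNE !vE; lia.
have {}d : dotM u w < 0.
  rewrite lt_def d andbT; apply/eqP => z; have := mulr_gt0 nu nw.
  by rewrite -dn -z expr0n.
apply: (primitive_collinear (v := v) pu).
- by move: pw; rewrite /primitiveM !latME gcdzN gcdNz.
- by rewrite !latME; lia.
- by move: d; rewrite /dotM evNE !vE.
- by move: nw; rewrite evNE !latME !vE; lia.
Qed.

Section HeightOrder.
Variables (P : set spaceNQ) (w : latM).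
Hypotheses (pP : polygon P) (pw : primitiveM w).
Let p (E : edge_data) : int := evN (normal E) (dir w).
Let Y (v : latN) : int := evN w v.

Lemma edge_height_gap E : is_edge P E ->
  exists2 l : int, 0 < l & Y (target E) = Y (source E) - l * p E.
Proof.
move=> eE; have [_ _ _ [l l0 hl]] := edge_facts pP eE.
by exists l => //; rewrite hl /Y evN_addZ evN_dirC /p; ring.
Qed.

(** On one side of the polygon, an edge [E'] that starts at a height strictly within
    the range of [E] would start on [E]: its source is on the inner side of [E]
    and both ends of [E] are on the inner side of [E'].  With [s = 1] this is
    the left side, with [s = -1] the right side. *)
Lemma no_edge_alongside s E E' : s = 1 \/ s = -1 -> is_edge P E -> is_edge P E' ->
  0 < s * p E -> 0 < s * p E' ->
  s * Y (target E) < s * Y (source E') -> s * Y (source E') < s * Y (source E) -> False.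
Proof.
move=> hs eE eE' pE pE' y1 y0.
have [fE pu lt0 [l l0 hl]] := edge_facts pP eE.
have [fE' pu' lt0' _] := edge_facts pP eE'.
have [_ [P0 _] [P1 _]] := fE; have [_ [P' _] _] := fE'.
have h := facet_min fE P'; have h0 := facet_min fE' P0; have h1 := facet_min fE' P1.
have k0 := evN_plucker (normal E) (normal E') w (source E' - source E).
have k1 := evN_plucker (normal E) (normal E') w (target E - source E').
have eq := facet_eq fE.
have ud : evN (normal E) (source E') = evN (normal E) (source E).
  move: k0 k1 pE pE' y1 y0; rewrite !evNB eq /p /Y.
  move: (evN (normal E') (dir (normal E))) => C k0 k1 pE pE' y1 y0.
  apply/eqP; rewrite eq_le h andbT leNgt; apply/negP => lt.
  case: hs pE pE' y1 y0 => ->; rewrite ?mul1r ?mulN1r ?oppr_gt0 ?ltrN2 => pE pE' y1 y0.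
    have C0 : C < 0 by nia.
    by nia.
  have C0 : C < 0 by nia.
  by nia.
have [j hj] := lattice_line pu ud.
have ar (a b : int) : area (source E + a *: dir (normal E)) (source E + b *: dir (normal E))
    = (b - a) * - evN (normal E) (source E).
  by rewrite /area !evNE !latNE !dirE; ring.
have hY a : Y (source E + a *: dir (normal E)) = Y (source E) - a * p E.
  by rewrite /Y evN_addZ evN_dirC /p; ring.
move: y1 y0; rewrite hl hj !hY => y1 y0.
have j0 : 0 < j by case: hs pE y0 => ->; nia.
have jl : j < l%:Z by case: hs pE y1 => ->; nia.
apply: (no_source_in_cone pP eE eE'); rewrite hj.
  have := ar 0 j; rewrite scale0r addr0 subr0 => ->.
  by rewrite mulr_gt0 ?oppr_gt0.
by rewrite hl ar mulr_gt0 ?oppr_gt0 ?subr_gt0.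
Qed.

(** Where the boundary stops descending the height has a global minimum, as [w] is
    a nonnegative combination of the two normals there; for [s = -1], a maximum. *)
Lemma turning_point s E E' v : is_edge P E -> is_edge P E' -> source E' = target E ->
  0 <= s * p E -> s * p E' <= 0 -> P (emb v) -> s * Y (target E) <= s * Y v.
Proof.
move=> eE eE' sE pE pE' Pv.
have [fE _ _ _] := edge_facts pP eE; have [fE' _ _ _] := edge_facts pP eE'.
have c := cross_next pP eE eE' sE.
have h := facet_min fE Pv; have h' := facet_min fE' Pv.
have k := evN_plucker (normal E) (normal E') w (v - target E).
have cE : evN (normal E') (dir (normal E)) =
    - (normal E 0 0 * normal E' 0 1 - normal E 0 1 * normal E' 0 0).
  by rewrite evNE !dirE; ring.
rewrite sE in h'; rewrite cE !evNB (facet_eq fE) in k.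
rewrite -subr_ge0 -mulrBr -(pmulr_rge0 _ c) mulrCA.
have -> : forall C, s * (C * (Y v - Y (target E))) = s * (- C * - (Y v - Y (target E))).
  by move=> C; rewrite mulrNN.
rewrite /Y -k mulrBr; apply: addr_ge0.
  by rewrite mulrA; apply: mulr_ge0 => //; rewrite subr_ge0.
by rewrite mulrA -mulNr; apply: mulr_ge0; rewrite ?oppr_ge0 ?subr_ge0.
Qed.

Lemma side_next E E' : is_edge P E -> is_edge P E' -> source E' = target E ->
  [/\ p E = 0 -> 0 < dotM (normal E) w -> p E' < 0,
      p E = 0 -> dotM (normal E) w <= 0 -> 0 < p E',
      p E' = 0 -> 0 < p E -> 0 < dotM (normal E') w &
      p E' = 0 -> p E < 0 -> dotM (normal E') w < 0].
Proof.
move=> eE eE' sE; have c := cross_next pP eE eE' sE.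
have nw := dir_norm (primitive_neq0 pw).
have k : p E * dotM (normal E') w - p E' * dotM (normal E) w =
   (normal E 0 0 * normal E' 0 1 - normal E 0 1 * normal E' 0 0) *
   (w 0 0 ^+ 2 + w 0 1 ^+ 2).
  by rewrite /p /dotM !evNE !dirE; ring.
have : 0 < p E * dotM (normal E') w - p E' * dotM (normal E) w by rewrite k mulr_gt0.
by split; nia.
Qed.

(** If a left and a right edge meet, the polygon has a single lowest point. *)
Lemma no_horizontal s E E' E'' : s = 1 \/ s = -1 -> is_edge P E -> is_edge P E' ->
  is_edge P E'' -> source E' = target E ->
  0 < s * p E -> s * p E' < 0 -> p E'' = 0 -> 0 < s * dotM (normal E'') w -> False.
Proof.
move=> hs eE eE' eE'' sE pE pE' pE'' dE''.
have [fE pu _ _] := edge_facts pP eE; have [fE' _ _ _] := edge_facts pP eE'.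
have [fE'' pu'' _ [l l0 hl]] := edge_facts pP eE''.
have [_ [P0 _] [P1 _]] := fE''; have [_ _ [Pv _]] := fE.
have nE : normal E'' = s *: w.
  have [h1 h2] := horizontal_normal pw pu'' pE''.
  case: hs dE'' => ->; rewrite ?mul1r ?mulN1r ?oppr_gt0 => d.
    by rewrite scale1r; apply: h1.
  by rewrite scaleN1r; apply: h2; lia.
have sY v : evN (s *: w) v = s * Y v by rewrite /Y !evNE !latME; ring.
have m := facet_min fE'' Pv; have eq := facet_eq fE''; rewrite nE !sY in m eq.
have key v : P (emb v) -> s * Y v = s * Y (target E) ->
    evN (normal E) v = evN (normal E) (target E).
  move=> PV yE; have h := facet_min fE PV; have h' := facet_min fE' PV.
  have k := evN_plucker (normal E) (normal E') w (v - target E).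
  have yE' : Y v = Y (target E) by case: hs yE => ->; lia.
  rewrite sE in h'; rewrite !evNB -!/(Y _) yE' subrr oppr0 mulr0 (facet_eq fE) in k *.
  rewrite -!/(p _) in k.
  move: k h h'; move: (evN (normal E) v) (evN (normal E) (source E)) => a b.
  move: (evN (normal E') v) (evN (normal E') (target E)) => a' b' k h h'.
  by case: hs pE pE' => ->; nia.
have y0 : s * Y (source E'') = s * Y (target E).
  apply/eqP; rewrite eq_le m; apply: (turning_point eE eE' sE) => //; exact: ltW.
have e0 := key _ P0 y0; have e1 := key _ P1 (etrans eq y0).
move: e1; rewrite hl evN_addZ e0 nE => /eqP.
rewrite -subr_eq0 addrC addKr mulf_eq0 => /orP[/eqP|]; first by lia.
have -> : evN (normal E) (dir (s *: w)) = s * p E.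
  by rewrite /p !evNE !dirE !latME; ring.
by rewrite gt_eqF.
Qed.

(** After the signs of the slopes of [E], of its successor and of [E'] have been
    settled, each case is linear arithmetic on heights. *)
Lemma height_between E E' : is_edge P E -> is_edge P E' ->
  let N := next_edge P E in
  (height_le w E N -> height_le w E E' -> height_le w E' N ->
     height_le w E' E || height_le w N E') /\
  (~~ height_le w E N -> (height_le w E E' -> height_le w E' E) /\
     (height_le w E' N -> height_le w N E')).
Proof.
move=> eE eE' N; have [eN sN] := next_edgeP pP eE; rewrite -/N in eN sN.
have [fE' _ _ _] := edge_facts pP eE'.
have [_ [P0 _] [P1 _]] := fE'.
have [l l0 hl] := edge_height_gap eE; have [l' l0' hl'] := edge_height_gap eE'.
have g1 : 0 < p E' -> Y (target E') < Y (source E') by rewrite hl'; clear -l0 l0'; nia.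
have g3 : 0 < p E -> Y (target E) < Y (source E) by rewrite hl; clear -l0 l0'; nia.
have g4 : p E < 0 -> Y (source E) < Y (target E) by rewrite hl; clear -l0 l0'; nia.
have g2 : p E' < 0 -> Y (source E') < Y (target E') by rewrite hl'; clear -l0 l0'; nia.
have d0 : p E' = 0 -> dotM (normal E') w != 0.
  have [_ pu' _ _] := edge_facts pP eE'; move=> p0.
  have nw := dir_norm (primitive_neq0 pw); have [h1 h2] := horizontal_normal pw pu' p0.
  apply/eqP => z; have e : normal E' = - w by apply: h2; rewrite z.
  by move: nw z; rewrite e /dotM !latME; clear; lia.
have [s1 s2 s3 s4] := side_next eE eN sN.
have a1 := @no_edge_alongside 1 _ _ (or_introl erefl) eE eE'.
have a2 := @no_edge_alongside (-1) _ _ (or_intror erefl) eE eE'.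
have t1 := @turning_point 1 _ _ _ eE eN sN _ _ P0.
have t2 := @turning_point 1 _ _ _ eE eN sN _ _ P1.
have t3 := @turning_point (-1) _ _ _ eE eN sN _ _ P0.
have t4 := @turning_point (-1) _ _ _ eE eN sN _ _ P1.
have n1 := @no_horizontal 1 _ _ _ (or_introl erefl) eE eN eE' sN.
have n2 := @no_horizontal (-1) _ _ _ (or_intror erefl) eE eN eE' sN.
rewrite /height_le /side /descent -!/(p _) -!/(Y _) sN.
move: {hl hl' l l0 l' l0' fE' P0 P1 eE eE' eN sN} s1 s2 s3 s4 a1 a2 t1 t2 t3 t4
  n1 n2 g1 g2 g3 g4 d0.
rewrite !mul1r !mulN1r !oppr_gt0 !oppr_ge0 !oppr_le0 !oppr_lt0 !ltrN2 !lerN2.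
move: (Y (source E)) (Y (target E)) (Y (source E')) (Y (target E')) => y0 y1 z0 z1.
move: (p E) (p N) (p E') (dotM (normal E) w) (dotM (normal N) w) (dotM (normal E') w).
move=> a b c da db dc; clear => s1 s2 s3 s4 a1 a2 t1 t2 t3 t4 n1 n2 g1 g2 g3 g4 d0.
(* The possible turns at the target of [E]: a horizontal edge is the bottom one
   when it comes after a left edge or before a right one. *)
have cases : a < 0 /\ b < 0 \/ a < 0 /\ 0 < b \/ a < 0 /\ b = 0 /\ db < 0 \/
    0 < a /\ b < 0 \/ 0 < a /\ 0 < b \/ 0 < a /\ b = 0 /\ 0 < db \/
    a = 0 /\ 0 < da /\ b < 0 \/ a = 0 /\ da <= 0 /\ 0 < b by clear -s1 s2 s3 s4; lia.
clear s1 s2 s3 s4; move: a1 a2 t1 t2 t3 t4 n1 n2 g1 g2 g3 g4 d0.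
case: cases => [[ha hb]|[[ha hb]|[[ha [hb hd]]|[[ha hb]|
  [[ha hb]|[[ha [hb hd]]|[[ha [hd hb]]|[ha [hd hb]]]]]]]]].
all: rewrite ?ha ?hb ?(lt_gtF ha) ?(lt_gtF hb) ?(ltW ha) ?(ltW hb) ?(lt_geF ha)
  ?(lt_geF hb) ?hd ?(lt_gtF hd) ?(le_gtF hd) ?ltxx /=.
all: have [hc|hc|hc] := ltrgtP c 0; rewrite /= ?hc; last (have [hdc|hdc] := ltrP 0 dc).
all: move=> /= *; repeat match goal with
  | H : is_true false -> _ |- _ => clear H
  | H : is_true true -> _ |- _ => specialize (H isT)
  | H : ?x = ?x -> _ |- _ => specialize (H erefl)
  end.
all: lia.
Qed.

End HeightOrder.

(** The edges, together with the horizontal faces even when these are points: a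
    mutation can turn such a point into an edge and conversely. *)
Definition ext_facet P w E : Prop :=
  facet P E /\ (0 < area (source E) (target E) \/ normal E = w \/ normal E = - w).

Lemma facet_exists P u : polygon P -> primitiveM u ->
  exists2 E, facet P E & normal E = u.
Proof.
move=> pP pu; have [[S PE] _] := pP; have un0 := primitive_neq0 pu.
have pP' := pP; rewrite PE in pP'.
have [v0 _ e0] := extreme_ex pP' un0 (or_introl erefl : (1 : int) = 1 \/ 1 = -1).
have [v1 _ e1] := extreme_ex pP' un0 (or_intror erefl : (-1 : int) = 1 \/ -1 = -1).
by exists (u, (v0, v1)); rewrite // PE; split.
Qed.

Lemma primitiveM_opp w : primitiveM w -> primitiveM (- w).
Proof. by rewrite /primitiveM !latME gcdzN gcdNz. Qed.

Lemma ext_finite P w : polygon P -> primitiveM w ->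
  finite_set [set E | ext_facet P w E].
Proof.
move=> pP pw; have [E1 f1 n1] := facet_exists pP pw.
have [E2 f2 n2] := facet_exists pP (primitiveM_opp pw).
apply: (@sub_finite_set _ _ ([set E | is_edge P E] `|` [set E1; E2])).
  move=> E [fE [ar|[nE|nE]]].
  - by left; apply/is_edgeP.
  - by right; left; apply: (facet_inj pP fE f1); rewrite n1.
  - by right; right; apply: (facet_inj pP fE f2); rewrite n2.
by rewrite finite_setU; split; [exact: edges_finite|exact: finite_set2].
Qed.

Definition ext_edges P w : seq edge_data :=
  sort (height_le w) (fset_set [set E | ext_facet P w E]).

Lemma mem_ext_edges P w E : polygon P -> primitiveM w ->
  (E \in ext_edges P w) = `[< ext_facet P w E >].
Proof.
move=> pP pw; rewrite /ext_edges mem_sort in_fset_set; last exact: ext_finite.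
by apply/idP/asboolP => [/set_mem|h]; last apply/mem_set.
Qed.

Lemma ext_edges_uniq P w : uniq (ext_edges P w).
Proof. by rewrite sort_uniq fset_uniq. Qed.

Lemma height_le_anti P w E E' : polygon P -> primitiveM w ->
  ext_facet P w E -> ext_facet P w E' ->
  height_le w E E' -> height_le w E' E -> E = E'.
Proof.
move=> pP pw [fE hE] [fE' hE'] l1 l2.
have [pu _ _] := fE; have [pu' _ _] := fE'.
have [se de] : side w (normal E) = side w (normal E') /\ descent w E = descent w E'.
  by move: l1 l2; rewrite /height_le; lia.
have [p0|pn0] := eqVneq (evN (normal E) (dir w)) 0.
  apply: (facet_inj pP fE fE').
  have p0' : evN (normal E') (dir w) = 0.
    move: se; rewrite /side p0.
    by case: (ltrgtP (evN (normal E') (dir w)) 0) => //=; case: ifP.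
  have [h1 h2] := horizontal_normal pw pu p0; have [h1' h2'] := horizontal_normal pw pu' p0'.
  move: se; rewrite /side p0 p0' /=; case: ltrP => d; case: ltrP => d' // _.
    by rewrite h1// h1'.
  by rewrite h2// h2'.
have isE F : facet P F -> evN (normal F) (dir w) != 0 ->
   0 < area (source F) (target F) \/ normal F = w \/ normal F = - w -> is_edge P F.
  move=> fF nF [ar|[e|e]]; first exact/is_edgeP.
    by move: nF; rewrite e evN_dir eqxx.
  have z : evN (- w) (dir w) = 0 by rewrite evNE !latME !dirE; ring.
  by move: nF; rewrite e z eqxx.
have pn0' : evN (normal E') (dir w) != 0.
  move: se pn0; rewrite /side; case: ltrgtP => // _; case: ltrgtP => //= _; case: ifP => //.
have eE := isE E fE pn0 hE; have eE' := isE E' fE' pn0' hE'.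
apply: (edge_source_inj pP eE eE').
have [_ [P0 _] _] := fE; have [_ [P0' _] _] := fE'.
have h := facet_min fE P0'; have h' := facet_min fE' P0.
have k := evN_plucker (normal E) (normal E') w (source E' - source E).
have yE : evN w (source E') = evN w (source E).
  by move: se de pn0 pn0'; rewrite /side /descent; do 2!case: ltrgtP => // _; lia.
rewrite !evNB yE subrr oppr0 mulr0 in k.
have ud : evN (normal E) (source E') = evN (normal E) (source E).
  have pp : 0 < evN (normal E) (dir w) * evN (normal E') (dir w).
    move: se pn0 pn0'; rewrite /side; case: ltrgtP => // p1; case: ltrgtP => // p2;
      rewrite ?p2 ?eqxx//= => _ _ _;
      by [rewrite nmulr_rgt0|rewrite mulr_gt0|case: ifP].
  have aux (p p' A B : int) : 0 < p * p' -> 0 <= A -> B <= 0 -> p * B - p' * A = 0 -> A = 0.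
    move=> {}pp A0 B0 e; have e2 : p * p * B = p * p' * A.
      by have := congr1 ( *%R p) e; lia.
    apply/eqP; rewrite eq_le A0 andbT -(pmulr_rle0 _ pp) -e2.
    by apply: mulr_ge0_le0 => //; rewrite -expr2 sqr_ge0.
  apply/eqP; rewrite -subr_eq0; apply/eqP; apply: (aux _ _ _ _ pp _ _ k).
    by rewrite subr_ge0.
  by rewrite subr_le0.
have [j hj] := lattice_line pu ud.
rewrite hj evN_addZ evN_dirC in yE.
have : j * evN (normal E) (dir w) = 0 by lia.
by move/eqP; rewrite mulf_eq0 (negPf pn0) orbF => /eqP j0; rewrite hj j0 scale0r addr0.
Qed.

Lemma edges_rot_height P w : polygon P -> primitiveM w -> exists k,
  [seq E <- ext_edges P w | 0 < area (source E) (target E)] = rot k (edges P).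
Proof.
move=> pP pw; set t := filter _ _.
have tE E : (E \in t) = `[< is_edge P E >].
  rewrite mem_filter mem_ext_edges//; apply/andP/asboolP.
    by move=> [ar /asboolP[fE _]]; apply/is_edgeP.
  by move=> /(is_edgeP _ pP)[fE ar]; split=> //; apply/asboolP; split=> //; left.
have isE E : E \in t -> is_edge P E by rewrite tE => /asboolP.
have ut : uniq t by rewrite filter_uniq// ext_edges_uniq.
have anti E E' : is_edge P E -> is_edge P E' -> height_le w E E' -> height_le w E' E -> E = E'.
  move=> /(is_edgeP _ pP)[f a] /(is_edgeP _ pP)[f' a'].
  by apply: (height_le_anti pP pw); split=> //; left.
apply: (@fcycle_rot _ (next_edge P)) => //; first exact: edges_uniq.
- by move=> E; rewrite tE mem_edges.
- exact: edges_fcycle.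
apply: (@fcycle_pairwise _ (height_le w)) => //.
- rewrite -(sorted_pairwise (@height_le_trans w)).
  apply: (sorted_filter (@height_le_trans w)); apply: sort_sorted; exact: height_le_total.
- by move=> E E' /isE h /isE h' /andP[]; apply: anti.
- by move=> E /isE h; rewrite tE; apply/asboolP; case: (next_edgeP pP h).
- by move=> E /isE; apply: next_edge_neq.
- move=> E E' /isE h /isE h' l1 l2 l3; have [hn _] := next_edgeP pP h.
  have [/(_ l1 l2 l3)] := height_between pP pw h h'.
  by case/orP => l _; [left|right]; apply: anti.
- move=> E E' /isE h /isE h' nl; have [hn _] := next_edgeP pP h.
  have [_ /(_ nl)[h1 h2]] := height_between pP pw h h'.
  by split=> l; [apply: anti => //; apply: h1|apply: anti => //; apply: h2].
Qed.

(** * Mutations *)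

Definition shear (w : latM) (c : int) (v : latN) : latN := v + (c * evN w v) *: dir w.

(** The action of the shear on normals: [shear_normalE]. *)
Definition shear_normal (w : latM) (c : int) (u : latM) : latM :=
  u - (c * evN u (dir w)) *: w.

Lemma frame_exists w : primitiveM w -> exists g, evN g (dir w) = 1.
Proof.
rewrite /primitiveM => pw; have [a [b ab]] := Bezoutz (w 0 0) (w 0 1).
exists (\row_(i < 2) if i == 0 then b else - a).
by rewrite evNE !dirE !mxE /=; lia.
Qed.

Lemma frame_det w g : evN g (dir w) = 1 ->
  (g 0 0)%:~R * (w 0 1)%:~R - (g 0 1)%:~R * (w 0 0)%:~R = 1 :> rat.
Proof.
rewrite -!rmorphM -rmorphB /= evNE !dirE => gw.
by rewrite -[RHS]/(1%:~R); congr (_%:~R); lia.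
Qed.

Lemma frame_inj w g x y : evN g (dir w) = 1 ->
  evQ w x = evQ w y -> evQ g x = evQ g y -> x = y.
Proof.
move=> /frame_det gw; rewrite !evQE => ew eg.
apply: colP2; rewrite -[LHS]mul1r -[RHS]mul1r -gw.
  by have := congr1 ( *%R (w 0 1)%:~R) eg; have := congr1 ( *%R (g 0 1)%:~R) ew; lra.
by have := congr1 ( *%R (w 0 0)%:~R) eg; have := congr1 ( *%R (g 0 0)%:~R) ew; lra.
Qed.

(** Pairing with [g] and [w] gives unimodular coordinates on the plane, in which
    [dir w] and [- dir g] form the dual basis. *)
Lemma evQ_frame w g u x : evN g (dir w) = 1 ->
  evQ u x = (evN u (dir w))%:~R * evQ g x - (evN u (dir g))%:~R * evQ w x.
Proof.
move=> /frame_det gw; rewrite -[LHS]mul1r -{1}gw !evQE !evNE !dirE.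
by rewrite !(rmorphD, rmorphM, rmorphN) /=; ring.
Qed.

Lemma areaQ_frame w g x y : evN g (dir w) = 1 ->
  areaQ x y = evQ g x * evQ w y - evQ g y * evQ w x.
Proof.
by move=> /frame_det gw; rewrite -[LHS]mul1r -{1}gw !evQE /areaQ; ring.
Qed.

(** With [s = 1]: every point of [Q] has, at the same height, a point of the image
    of [P] under the shear weakly to its left; with [s = -1], to its right. *)
Definition dominates (w g : latM) (s c : int) (P Q : set spaceNQ) : Prop :=
  forall y, Q y -> exists2 x, P x &
    evQ w x = evQ w y /\ s%:~R * (evQ g x + c%:~R * evQ w y) <= s%:~R * evQ g y.

(** The reverse comparison, at the vertices of [P] only, since these are the
    points that a remainder plus the dilated factor is required to contain. *)
Definition dominates_vertices (w g : latM) (s c : int) (P Q : set spaceNQ) : Prop :=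
  forall v, vertex P v -> exists2 y, Q y & evQ w y = (evN w v)%:~R /\
    s%:~R * evQ g y <= s%:~R * (evQ g (emb v) + c%:~R * (evN w v)%:~R).

Lemma evN_shear w g c v : evN g (dir w) = 1 ->
  evN w (shear w c v) = evN w v /\ evN g (shear w c v) = evN g v + c * evN w v.
Proof. by move=> gw; rewrite /shear !evN_addZ evN_dir gw; split; ring. Qed.

(** The condition on [u] says that, near the normal [u] tilted towards the side that
    breaks ties, the minimum over [P] is on the left ([s = 1]) or on the right
    ([s = -1]).  The point of [Q] at the height of the sheared vertex is then
    caught between the two comparisons; it is therefore that vertex itself. *)
Lemma extreme_shear P Q w g s t c u v : polygon P -> evN g (dir w) = 1 ->
  s = 1 \/ s = -1 -> t = 1 \/ t = -1 -> u != 0 ->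
  dominates w g s c P Q -> dominates_vertices w g s c P Q ->
  0 < s * evN u (dir w) \/ (evN u (dir w) = 0 /\ t * s * evN u (dir g) < 0) ->
  extreme P u t v -> extreme Q (shear_normal w c u) t (shear w c v).
Proof.
move=> pP gw hs ht un0 dom domv hu ev.
have lt0 : evQ u (emb v) < 0 by rewrite evQ_emb ltrz0; apply: extreme_lt0 pP un0 ev.
have uE x : evQ (shear_normal w c u) x = (evN u (dir w))%:~R * (evQ g x - c%:~R * evQ w x)
    - (evN u (dir g))%:~R * evQ w x.
  rewrite mulrBr -addrA [X in _ + X]addrC addrA -(evQ_frame _ _ gw) /shear_normal !evQE !latME.
  by rewrite !(rmorphB, rmorphD, rmorphM, rmorphN) /=; ring.
have [sw sg] : evQ w (emb (shear w c v)) = evQ w (emb v) /\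
    evQ g (emb (shear w c v)) = evQ g (emb v) + c%:~R * evQ w (emb v).
  have [h1 h2] := evN_shear c v gw.
  by rewrite !evQ_emb h1 h2 rmorphD rmorphM.
have ext x : P x -> (evN u (dir w))%:~R * evQ g (emb v) - (evN u (dir g))%:~R * evQ w (emb v)
   <= (evN u (dir w))%:~R * evQ g x - (evN u (dir g))%:~R * evQ w x /\
   ((evN u (dir w))%:~R * evQ g x - (evN u (dir g))%:~R * evQ w x =
    (evN u (dir w))%:~R * evQ g (emb v) - (evN u (dir g))%:~R * evQ w (emb v) ->
    0 <= t%:~R * (evQ g (emb v) * evQ w x - evQ g x * evQ w (emb v))).
  by move=> /(proj2 ev); rewrite -!(evQ_frame _ _ gw) (areaQ_frame _ _ gw).
rewrite (evQ_frame _ _ gw) in lt0.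
have hu' : 0 < s%:~R * (evN u (dir w))%:~R :> rat \/ ((evN u (dir w))%:~R = 0 :> rat /\
     t%:~R * s%:~R * (evN u (dir g))%:~R < 0 :> rat).
  case: hu => [h|[-> h]]; [left|right]; first by rewrite -rmorphM /= ltr0z.
  by rewrite -!rmorphM /= ltrz0.
have hsQ : s%:~R = 1 :> rat \/ s%:~R = -1 :> rat by case: hs => ->; [left|right].
have htQ : t%:~R = 1 :> rat \/ t%:~R = -1 :> rat by case: ht => ->; [left|right].
split.
  have [y Qy [yw yg]] := domv v (extreme_vertex pP un0 ht ev).
  have [x Px [xw xg]] := dom y Qy.
  suff -> : emb (shear w c v) = y by [].
  have [h1 h2] := ext x Px.
  apply: (frame_inj gw); first by rewrite sw yw evQ_emb.
  rewrite sg; rewrite -evQ_emb in yw yg; rewrite yw in xw xg; rewrite xw in h1 h2.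
  move: yg xg h1 h2 lt0 hu'.
  move: (evQ g (emb v)) (evQ w (emb v)) (evQ g x) (evQ g y).
  move: ((evN u (dir w))%:~R : rat) ((evN u (dir g))%:~R : rat) => p q X Y X' X''.
  move: (c%:~R : rat) => d h3 h4 h1 h2 lt0 hu'.
  (* The two comparisons squeeze [y] onto the sheared vertex, once [x] is known
     to be as far to the side as the vertex, which is extreme. *)
  have eX : X' = X.
    case: hu' => [h|[p0 h]].
      by case: hsQ h h3 h4 => ->; nra.
    have := h2; rewrite p0 !mul0r => /(_ erefl).
    rewrite p0 mul0r add0r in lt0.
    case: hsQ htQ h h3 h4 => -> [->|->]; rewrite ?mul1r ?mulN1r ?opprK => h h3 h4 h5.
    - have Y0 : Y < 0 by nra.
      by nra.
    - have Y0 : 0 < Y by nra.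
      by nra.
    - have Y0 : 0 < Y by nra.
      by nra.
    - have Y0 : Y < 0 by nra.
      by nra.
  by rewrite eX in h4; case: hsQ h3 h4 => ->; lra.
move=> y Qy; have [x Px [xw xg]] := dom y Qy.
have [h1 h2] := ext x Px.
rewrite !uE (areaQ_frame _ _ gw) sw sg addrK; rewrite xw in h1 h2.
move: xg h1 h2 lt0 hu'; clear -hsQ htQ.
move: (evQ g (emb v)) (evQ w (emb v)) (evQ g x) (evQ g y) (evQ w y).
move: ((evN u (dir w))%:~R : rat) ((evN u (dir g))%:~R : rat) => p q X Y X' X'' Y'.
move: (c%:~R : rat) => d xg h1 h2 lt0 hu'.
have le : p * X' <= p * (X'' - d * Y').
  case: hu' => [h|[-> _]]; last by rewrite !mul0r.
  by case: hsQ h xg => ->; nra.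
split; first by lra.
move=> e; have e1 : p * X' = p * (X'' - d * Y') by lra.
have := h2 _; rewrite e1 => /(_ e).
case: hu' => [h|[p0 h]].
  have -> : X' = X'' - d * Y'.
    by apply: (mulfI _ e1); apply/eqP => p0; rewrite p0 mulr0 ltxx in h.
  by move=> h5; lra.
rewrite p0 !mul0r !add0r in e lt0.
have eY : Y' = Y.
  have q0 : q != 0 by apply/eqP => q0; rewrite q0 mulr0 ltxx in h.
  by apply: (mulfI q0); lra.
subst Y'.
case: hsQ htQ h xg => -> [->|->]; rewrite ?mul1r ?mulN1r ?opprK => h h3 h4.
- have Y0 : Y < 0 by nra.
  by nra.
- have Y0 : 0 < Y by nra.
  by nra.
- have Y0 : 0 < Y by nra.
  by nra.
- have Y0 : Y < 0 by nra.
  by nra.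
Qed.

Lemma slice_sub P w h x : polygon P -> slice P w h x -> P x /\ evQ w x = h%:~R.
Proof.
move=> pP; move: x; apply: conv_min => [x y l [Px ex] [Py ey] l01|].
  split; first exact: (polygon_convex pP).
  by rewrite evQ_comb ex ey -mulrDl addrC subrK mul1r.
by move=> x [Px [v /= hv e]]; split=> //; rewrite -e evQ_emb hv.
Qed.

Lemma hmin_le P w x : polygon P -> w != 0 -> P x -> hmin P w <= evQ w x.
Proof.
move=> pP w0 Px; have [[S PE] _] := pP; have pP' := pP; rewrite PE in pP'.
have [v _ ev] := extreme_ex pP' w0 (or_introl erefl : (1 : int) = 1 \/ 1 = -1).
rewrite -PE in ev.
have [_ lb] : ((evQ w @` P) `&` lbound (evQ w @` P)) (hmin P w).
  apply: (@xgetPex _ 0); exists (evQ w (emb v)); split.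
    by exists (emb v) => //; case: ev.
  by move=> _ [z Pz <-]; case: (proj2 ev z Pz).
by apply: lb; exists x.
Qed.

Lemma hmax_ge P w x : polygon P -> w != 0 -> P x -> evQ w x <= hmax P w.
Proof.
move=> pP w0 Px; have [[S PE] _] := pP; have pP' := pP; rewrite PE in pP'.
have w0' : - w != 0 by rewrite oppr_eq0.
have evQN z : evQ (- w) z = - evQ w z by rewrite !evQE !latME !rmorphN /=; ring.
have [v _ ev] := extreme_ex pP' w0' (or_introl erefl : (1 : int) = 1 \/ 1 = -1).
rewrite -PE in ev.
have [_ ub] : ((evQ w @` P) `&` ubound (evQ w @` P)) (hmax P w).
  apply: (@xgetPex _ 0); exists (evQ w (emb v)); split.
    by exists (emb v) => //; case: ev.
  by move=> _ [z Pz <-]; have := proj1 (proj2 ev z Pz); rewrite !evQN lerN2.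
by apply: ub; exists x.
Qed.

Lemma evQD u x y : evQ u (x + y) = evQ u x + evQ u y.
Proof. by rewrite !evQE !mxE; ring. Qed.

Lemma evQZ u (c : rat) x : evQ u (c *: x) = c * evQ u x.
Proof. by rewrite !evQE !mxE; ring. Qed.

(** The left end ([s = 1]) or the right end ([s = -1]) of the factor. *)
Lemma factor_end w g F s : evN g (dir w) = 1 -> s = 1 \/ s = -1 ->
  lattice_polytope F -> evQ w @` F = [set 0] ->
  exists2 c : int, F (c%:~R *: emb (dir w)) &
    forall x, F x -> s%:~R * c%:~R <= s%:~R * evQ g x.
Proof.
move=> gw hs [S FE] Fw.
have F0 x : F x -> evQ w x = 0.
  by move=> Fx; have : (evQ w @` F) (evQ w x) by [exists x]; rewrite Fw.
have Sn : S != [::].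
  apply/eqP => S0; have [x Fx _] : (evQ w @` F) 0 by rewrite Fw.
  move: Fx; rewrite FE => Fx; have [x0 [z]] := conv_neq0 (ex_intro _ _ Fx).
  by rewrite /= S0.
have [v vS hv] := exists_lexmin (fun x => s * evN g x) (fun=> 0) Sn.
have Fv : F (emb v) by rewrite FE; apply: sub_conv; exists v.
exists (evN g v).
  suff -> : (evN g v)%:~R *: emb (dir w) = emb v by [].
  apply: (frame_inj gw); rewrite evQZ !evQ_emb.
    by rewrite evN_dir mulr0 -evQ_emb F0.
  by rewrite gw mulr1.
have sg x : s%:~R * evQ g x = evQ (s *: g) x.
  by rewrite !evQE !latMZ !rmorphM /=; ring.
move=> x; rewrite FE -[(evN g v)%:~R]evQ_emb !sg; move: x.
apply: conv_min; first exact: convex_evQ.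
move=> _ [x /= xS <-]; rewrite -!sg !evQ_emb -!rmorphM /= ler_int.
by case: (hv x xS) => [/ltW//|[-> _]].
Qed.

Section MutationOfPolygons.
Variables (P : set spaceNQ) (w g : latM) (F : set spaceNQ) (R : int -> set spaceNQ).
Variables s c : int.
Hypotheses (pP : polygon P) (pw : primitiveM w) (gw : evN g (dir w) = 1).
Hypotheses (Fw : evQ w @` F = [set 0]) (adm : admissible P w F R).
Hypotheses (Fc : F (c%:~R *: emb (dir w))).
Hypotheses (Fge : forall x, F x -> s%:~R * c%:~R <= s%:~R * evQ g x).

Let F0 x : F x -> evQ w x = 0.
Proof. by move=> Fx; have : (evQ w @` F) (evQ w x) by [exists x]; rewrite Fw. Qed.

(** At a negative height, adding back the extreme point of the dilated factor leads
    from the remainder into [P]. *)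
Lemma mut_dominates : dominates w g s c P (mut P w F R).
Proof.
apply: conv_min.
  move=> y y' l [x Px [xw xg]] [x' Px' [xw' xg']] l01.
  exists (l *: x + (1 - l) *: x'); first exact: (polygon_convex pP).
  rewrite !evQ_comb xw xw'; split=> //.
  by case/andP: l01 => l0 l1; nra.
move=> y [[h /= [hm h0] Ry]|[h /= [h0 hM] [p Sp [_ [x Fx <-] <-]]]].
  have [_ _ sub] := adm hm h0.
  pose x := y + `|h|%:~R *: (c%:~R *: emb (dir w)).
  have [Px xh] : P x /\ evQ w x = h%:~R.
    apply: slice_sub => //; apply: sub; exists y => //.
    by exists (`|h|%:~R *: (c%:~R *: emb (dir w))) => //; exists (c%:~R *: emb (dir w)).
  have xw : evQ w x = evQ w y by rewrite evQD !evQZ evQ_emb evN_dir !mulr0 addr0.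
  exists x => //; split=> //.
  rewrite -xw xh evQD !evQZ evQ_emb gw mulr1 ltr0_norm// rmorphN /=.
  by rewrite (_ : _ + _ = evQ g y)//; ring.
have [Pp ph] := slice_sub pP Sp.
exists p => //; rewrite !evQD !evQZ (F0 Fx) mulr0 addr0; split=> //.
rewrite ph; have hQ : 0 <= h%:~R :> rat by rewrite ler0z.
by have := Fge Fx; nra.
Qed.

Lemma mut_dominates_vertices : dominates_vertices w g s c P (mut P w F R).
Proof.
move=> v vv; have w0 := primitive_neq0 pw.
have Pv : P (emb v).
  by case: (vv) => u fu; have : face P u (emb v) by [rewrite fu]; case.
have [h0|h0] := ltP (evN w v) 0.
  have hm : hmin P w <= (evN w v)%:~R by rewrite -evQ_emb; apply: hmin_le.
  have [_ sub _] := adm hm h0.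
  have [r Rr [_ [x Fx <-] e]] : minkowski (R (evN w v)) (dilate `|evN w v|%:~R F) (emb v).
    by apply: sub; exists v.
  exists r; first by apply: sub_conv; left; exists (evN w v).
  have ew := congr1 (evQ w) e; have eg := congr1 (evQ g) e.
  rewrite evQD evQZ (F0 Fx) mulr0 addr0 evQ_emb in ew.
  rewrite evQD evQZ ltr0_norm// rmorphN /= in eg.
  split=> //; rewrite -eg; have := Fge Fx.
  have hQ : (evN w v)%:~R < 0 :> rat by rewrite ltrz0.
  by nra.
exists (emb v + (evN w v)%:~R *: (c%:~R *: emb (dir w))).
  apply: sub_conv; right; exists (evN w v) => /=.
    by split=> //; rewrite -evQ_emb; apply: hmax_ge.
  exists (emb v); first by apply: sub_conv; split=> //; exists v.
  by exists ((evN w v)%:~R *: (c%:~R *: emb (dir w))) => //; exists (c%:~R *: emb (dir w)).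
rewrite !evQD !evQZ !evQ_emb evN_dir gw !mulr0 addr0 mulr1; split=> //.
by rewrite [c%:~R * _]mulrC.
Qed.

End MutationOfPolygons.

(** * Invariance of the directed singularity content *)

Lemma facet_num P E : polygon P -> facet P E ->
  exists2 l : nat, target E = source E + l%:Z *: dir (normal E) &
   [/\ edge_length E = l, (edge_height E)%:Z = - evN (normal E) (source E) &
       area (source E) (target E) = l%:Z * - evN (normal E) (source E)].
Proof.
move=> pP fE; have [l hl] := facet_len pP fE; have [pu _ _] := fE.
have lt0 := facet_lt0 pP fE.
exists l => //; split; first exact: edge_length_eq.
  by rewrite /edge_height; lia.
by rewrite hl /area !evNE !latNE !dirE; ring.
Qed.

(** Faces that are points have length 0, hence contribute neither segments nor a
    residue. *)
Lemma SC_ext_edges P w : polygon P -> primitiveM w ->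
  num_T P = (\sum_(E <- ext_edges P w) num_segments E)%N /\
  exists k, [seq res_hermite E | E <- ext_edges P w & (0 < res_length E)%N] =
            rot k (basket P).
Proof.
move=> pP pw; have [k hk] := edges_rot_height pP pw.
have flat E : E \in ext_edges P w -> ~~ (0 < area (source E) (target E)) ->
    num_segments E = 0%N /\ res_length E = 0%N.
  rewrite mem_ext_edges// => /asboolP[fE _]; have lt0 := facet_lt0 pP fE.
  have [l _ [lE _ ->]] := facet_num pP fE.
  rewrite pmulr_lgt0 ?oppr_gt0// -leNgt => l0.
  by rewrite /num_segments /res_length lE (_ : l = 0%N) ?div0n ?mod0n//; lia.
split.
  rewrite /num_T (perm_big (rot k (edges P))) /=; last by rewrite perm_sym perm_rot.
  rewrite -hk big_filter [RHS](bigID (fun E => 0 < area (source E) (target E))) /=.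
  rewrite [X in (_ + X)%N]big_seq_cond [X in (_ + X)%N]big1 ?addn0// => E /andP[h1 h2].
  by case: (flat E h1 h2).
have -> : [seq E <- ext_edges P w | (0 < res_length E)%N] =
   [seq E <- [seq E <- ext_edges P w | 0 < area (source E) (target E)] |
      (0 < res_length E)%N].
  rewrite -filter_predI; apply: eq_in_filter => E hE /=.
  case: (boolP (0 < area (source E) (target E))) => [|h]; first by rewrite andbT.
  by case: (flat E hE h) => _ ->.
rewrite hk /basket; have [m ->] := filter_rot (fun E => 0 < res_length E)%N k (edges P).
by exists m; rewrite map_rot.
Qed.

Lemma primitiveMP u : primitiveM u <-> exists v, evN u v = 1.
Proof.
rewrite /primitiveM; split=> [pu|[v]].
  have [a [b ab]] := Bezoutz (u 0 0) (u 0 1); rewrite pu in ab.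
  exists (\col_(i < 2) if i == 0 then a else b).
  by rewrite evNE !mxE /=; lia.
rewrite evNE => e.
have : (gcdz (u 0%R 0%R) (u 0%R 1%R) %| (v 0 0 * u 0 0 + v 1 0 * u 0 1)%R)%Z.
  by rewrite rpredD// dvdz_mull// ?dvdz_gcdl ?dvdz_gcdr.
rewrite (_ : _ + _ = 1); last by lia.
by rewrite dvdz1 => /eqP; have : 0 <= gcdz (u 0 0) (u 0 1) by []; lia.
Qed.

Lemma shear_unimodular w c : exists2 B : 'M[int]_2, B \in unitmx &
  forall v, shear w c v = B *m v.
Proof.
have E d v : shear w d v = (1%:M + d *: (dir w *m w)) *m v.
  rewrite mulmxDl mul1mx -scalemxAl -mulmxA /shear -scalerA.
  congr (_ + _ *: _); apply/colP => i.
  by rewrite [RHS]mxE big_ord1 mxE mulrC.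
exists (1%:M + c *: (dir w *m w)) => //.
apply: (@mulmx1_unit _ _ _ (1%:M + (- c) *: (dir w *m w)) _).1.
have w0 : w *m dir w = 0.
  by apply/matrixP => i j; rewrite !ord1 [RHS]mxE; apply: evN_dir.
have N2 : (dir w *m w) *m (dir w *m w) = 0.
  by rewrite mulmxA -(mulmxA (dir w)) w0 mulmx0 mul0mx.
rewrite mulmxDl mul1mx mulmxDr mulmx1 -!scalemxAl -scalemxAr N2 !scaler0 addr0.
by rewrite -addrA -scalerDl addNr scale0r addr0.
Qed.

Lemma dir_shear w c u : dir (shear_normal w c u) = shear w c (dir u).
Proof.
rewrite /shear evN_dirC /shear_normal.
by apply: colP2; rewrite !latNE !dirE !latME; ring.
Qed.

Lemma shear_normalE w c u v : evN (shear_normal w c u) (shear w c v) = evN u v.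
Proof.
rewrite /shear evN_addZ.
have sE x : evN (shear_normal w c u) x = evN u x - c * evN u (dir w) * evN w x.
  by rewrite /shear_normal !evNE !latME; ring.
by rewrite !sE evN_dir; ring.
Qed.

Lemma area_shear w c v v' : area (shear w c v) (shear w c v') = area v v'.
Proof. by rewrite /shear /area !evNE !latNE !dirE; ring. Qed.

Lemma shear_normal_slope w c u : evN (shear_normal w c u) (dir w) = evN u (dir w).
Proof. by rewrite /shear_normal !evNE !latME !dirE; ring. Qed.

Lemma shear_normal_id w c u : evN u (dir w) = 0 -> shear_normal w c u = u.
Proof. by move=> h; rewrite /shear_normal h mulr0 scale0r subr0. Qed.

Section Transport.
Variables (P Q : set spaceNQ) (w g : latM) (a b : int).
Hypotheses (pP : polygon P) (pQ : polygon Q) (pw : primitiveM w).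
Hypotheses (gw : evN g (dir w) = 1).
Hypotheses (domL : dominates w g 1 a P Q) (domR : dominates w g (-1) b P Q).
Hypotheses (vtxL : dominates_vertices w g 1 a P Q).
Hypotheses (vtxR : dominates_vertices w g (-1) b P Q).

(** The shear that moves the source of the face with inner normal [u]: the left one
    for a source on the left side, which includes the bottom face, whose source
    is its left end. *)
Definition source_shear (u : latM) : int :=
  if 0 < evN u (dir w) then a else if evN u (dir w) < 0 then b
  else if 0 < dotM u w then a else b.

(** The same for targets, where the bottom face is on the right and the top face on
    the left. *)
Definition target_shear (u : latM) : int :=
  if 0 < evN u (dir w) then a else if evN u (dir w) < 0 then b
  else if 0 < dotM u w then b else a.

Definition transport (E : edge_data) : edge_data :=
  (shear_normal w (source_shear (normal E)) (normal E),
   (shear w (source_shear (normal E)) (source E),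
    shear w (target_shear (normal E)) (target E))).

Lemma normal_transport E :
  normal (transport E) = shear_normal w (source_shear (normal E)) (normal E).
Proof. by []. Qed.

Lemma source_transport E :
  source (transport E) = shear w (source_shear (normal E)) (source E).
Proof. by []. Qed.

Lemma target_transport E :
  target (transport E) = shear w (target_shear (normal E)) (target E).
Proof. by []. Qed.

Lemma target_shearE u : evN u (dir w) != 0 -> target_shear u = source_shear u.
Proof. by rewrite /target_shear /source_shear; case: ltrgtP. Qed.

Lemma area_transport E : evN (normal E) (dir w) != 0 ->
  area (source (transport E)) (target (transport E)) = area (source E) (target E).
Proof.
move=> p0; rewrite -[RHS](area_shear w (source_shear (normal E))).
by rewrite -{2}(target_shearE p0).
Qed.

Lemma shear_normal_target u :
  shear_normal w (source_shear u) u = shear_normal w (target_shear u) u.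
Proof.
have [h|h] := eqVneq (evN u (dir w)) 0; first by rewrite !shear_normal_id.
by rewrite target_shearE.
Qed.

Lemma extreme_source u v : primitiveM u -> extreme P u 1 v ->
  extreme Q (shear_normal w (source_shear u) u) 1 (shear w (source_shear u) v).
Proof.
move=> pu; have un0 := primitive_neq0 pu.
rewrite /source_shear; case: (ltrgtP (evN u (dir w)) 0) => h.
- apply: (extreme_shear pP gw _ _ un0 domR vtxR); [by right|by left|].
  by left; rewrite mulN1r oppr_gt0.
- apply: (extreme_shear pP gw _ _ un0 domL vtxL); [by left|by left|].
  by left; rewrite mul1r.
have [h1 h2] := horizontal_normal pw pu h.
have wg : evN w (dir g) = -1 by rewrite evN_dirC gw.
case: ltrP => d.
  apply: (extreme_shear pP gw _ _ un0 domL vtxL); [by left|by left|].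
  by right; rewrite (h1 d) wg in h *.
apply: (extreme_shear pP gw _ _ un0 domR vtxR); [by right|by left|].
right; split=> //; rewrite (h2 d) (_ : evN (- w) (dir g) = 1)//.
by rewrite evNE !latME -[RHS]opprK -wg evNE; ring.
Qed.

Lemma extreme_target u v : primitiveM u -> extreme P u (-1) v ->
  extreme Q (shear_normal w (target_shear u) u) (-1) (shear w (target_shear u) v).
Proof.
move=> pu; have un0 := primitive_neq0 pu.
rewrite /target_shear; case: (ltrgtP (evN u (dir w)) 0) => h.
- apply: (extreme_shear pP gw _ _ un0 domR vtxR); [by right|by right|].
  by left; rewrite mulN1r oppr_gt0.
- apply: (extreme_shear pP gw _ _ un0 domL vtxL); [by left|by right|].
  by left; rewrite mul1r.
have [h1 h2] := horizontal_normal pw pu h.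
have wg : evN w (dir g) = -1 by rewrite evN_dirC gw.
case: ltrP => d.
  apply: (extreme_shear pP gw _ _ un0 domR vtxR); [by right|by right|].
  by right; rewrite (h1 d) wg in h *.
apply: (extreme_shear pP gw _ _ un0 domL vtxL); [by left|by right|].
right; split=> //; rewrite (h2 d) (_ : evN (- w) (dir g) = 1)//.
by rewrite evNE !latME -[RHS]opprK -wg evNE; ring.
Qed.

Lemma transport_facet E : facet P E -> facet Q (transport E).
Proof.
move=> [pu e0 e1]; split.
- have [v hv] := proj1 (primitiveMP _) pu; apply/primitiveMP.
  by exists (shear w (source_shear (normal E)) v); rewrite shear_normalE.
- exact: extreme_source.
- by rewrite normal_transport shear_normal_target; apply: extreme_target.
Qed.

Lemma transport_normal_inj E E' : primitiveM (normal E) -> primitiveM (normal E') ->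
  normal (transport E) = normal (transport E') -> normal E = normal E'.
Proof.
rewrite /transport /= => pu pu' e.
have p : evN (normal E) (dir w) = evN (normal E') (dir w).
  by have := congr1 (fun u => evN u (dir w)) e; rewrite !shear_normal_slope.
have [h|h] := eqVneq (evN (normal E) (dir w)) 0.
  by move: e; rewrite !shear_normal_id -?p.
have ss : source_shear (normal E) = source_shear (normal E').
  by rewrite /source_shear -p; move: h; case: ltrgtP.
by move: e; rewrite /shear_normal p ss => /addIr.
Qed.

Lemma evN_opp_dir : evN (- w) (dir w) = 0.
Proof. by rewrite evNE !latME !dirE; ring. Qed.

Lemma ext_facet_slopeP S E : facet S E -> ext_facet S w E <->
  (evN (normal E) (dir w) != 0 -> 0 < area (source E) (target E)).
Proof.
move=> fE; have [pu _ _] := fE; split.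
  by case=> _ [//|[->|->]]; rewrite ?evN_dir ?evN_opp_dir eqxx.
move=> h; split=> //; have [p0|/h] := eqVneq (evN (normal E) (dir w)) 0; last by left.
right; have [h1 h2] := horizontal_normal pw pu p0.
by case: (ltrP 0 (dotM (normal E) w)) => d; [left; apply: h1|right; apply: h2].
Qed.

Lemma transport_ext E : facet P E -> ext_facet Q w (transport E) <-> ext_facet P w E.
Proof.
move=> fE; rewrite !ext_facet_slopeP//; last exact: transport_facet.
rewrite normal_transport shear_normal_slope.
by split=> h p0; have := h p0; rewrite area_transport.
Qed.

(** A normal determines its facet, so it suffices to invert the action on normals. *)
Lemma transport_surj E' : ext_facet Q w E' -> exists2 E, ext_facet P w E & transport E = E'.
Proof.
move=> xE'; have [fE' _] := xE'; have [pu' _ _] := fE'.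
set u' := normal E' in pu' *; set c := source_shear u'.
pose u := shear_normal w (- c) u'.
have pu : primitiveM u.
  have [v hv] := proj1 (primitiveMP _) pu'; apply/primitiveMP.
  by exists (shear w (- c) v); rewrite shear_normalE.
have sl : evN u (dir w) = evN u' (dir w) by rewrite shear_normal_slope.
have ss : source_shear u = c.
  rewrite /c /source_shear sl; have [h|h] := eqVneq (evN u' (dir w)) 0.
    by rewrite /u shear_normal_id.
  by move: h; case: ltrgtP.
have [E fE nE] := facet_exists pP pu.
have tE : transport E = E'.
  apply: (facet_inj pQ (transport_facet fE) fE').
  rewrite normal_transport nE ss /shear_normal sl /u /shear_normal.
  by rewrite mulNr scaleNr opprK addrK.
by exists E => //; apply/transport_ext => //; rewrite tE.
Qed.

Lemma height_le_transport E E' :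
  height_le w (transport E) (transport E') = height_le w E E'.
Proof.
have sideE F : side w (normal (transport F)) = side w (normal F).
  rewrite /side normal_transport shear_normal_slope.
  by case: ltrgtP => // /esym h; rewrite shear_normal_id.
have desE F : descent w (transport F) = descent w F.
  rewrite /descent normal_transport shear_normal_slope /=.
  by have [-> _] := evN_shear (source_shear (normal F)) (source F) gw.
by rewrite /height_le !sideE !desE.
Qed.

Lemma ext_edges_transport : ext_edges Q w = map transport (ext_edges P w).
Proof.
have xP E : E \in ext_edges P w -> ext_facet P w E by rewrite mem_ext_edges// => /asboolP.
have xQ E : E \in ext_edges Q w -> ext_facet Q w E by rewrite mem_ext_edges// => /asboolP.
apply: (@sorted_eq_in _ (height_le w)).
- by move=> E' E E'' _ _ _; apply: height_le_trans.
- by move=> E E' /xQ h /xQ h' /andP[]; apply: height_le_anti pQ pw h h'.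
- by apply: sort_sorted; apply: height_le_total.
- rewrite sorted_map (@eq_sorted _ _ (height_le w)).
    by apply: sort_sorted; apply: height_le_total.
  by move=> E E' /=; rewrite height_le_transport.
apply: uniq_perm; first exact: ext_edges_uniq.
  rewrite map_inj_in_uniq ?ext_edges_uniq// => E E' /xP[h _] /xP[h' _] e.
  apply: (facet_inj pP h h'); apply: transport_normal_inj; rewrite ?e//.
    by case: h.
  by case: h'.
move=> E'; rewrite mem_ext_edges//; apply/asboolP/mapP.
  move=> /transport_surj[E xE <-]; exists E => //.
  by rewrite mem_ext_edges//; apply/asboolP.
by move=> [E /xP xE ->]; apply/transport_ext => //; case: xE.
Qed.

(** The number of segments that the mutation adds to a face: [b - a] for the top,
    [a - b] for the bottom, and 0 otherwise. *)
Definition excess (E : edge_data) : int :=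
  source_shear (normal E) - target_shear (normal E).

Lemma transport_num E : facet P E ->
  [/\ (num_segments (transport E))%:Z = excess E + (num_segments E)%:Z,
      res_length (transport E) = res_length E &
      res_hermite (transport E) = res_hermite E].
Proof.
move=> fE; have fT := transport_facet fE.
have [l hl [lE hE aE]] := facet_num pP fE.
have [l' hl' [lE' hE' aE']] := facet_num pQ fT.
have lt0 := facet_lt0 pP fE; have [pu _ _] := fE; have [pu' _ _] := fT.
have hh : edge_height (transport E) = edge_height E.
  by apply/eqP; rewrite -eqz_nat hE hE' normal_transport shear_normalE.
have h0 : (edge_height E)%:Z != 0 by lia.
have ll : l'%:Z = excess E * (edge_height E)%:Z + l%:Z.
  have : area (source (transport E)) (target (transport E)) =
      (excess E * (edge_height E)%:Z + l%:Z) * (edge_height E)%:Z.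
    (* On a horizontal face the two ends are moved by different shears. *)
    rewrite hE; have [p0|pn0] := eqVneq (evN (normal E) (dir w)) 0; last first.
      by rewrite area_transport// /excess target_shearE// aE subrr mul0r add0r.
    have [h1 h2] := horizontal_normal pw pu p0.
    rewrite source_transport target_transport hl /excess.
    move: (source_shear _) (target_shear _) => cs ct.
    case: (ltrP 0 (dotM (normal E) w)) => d; [rewrite (h1 d)|rewrite (h2 d)];
      by rewrite /shear /area !evNE !(latNE, dirE, latME); ring.
  rewrite aE' -hE' hh => /(mulIf h0); exact.
have num : (num_segments (transport E))%:Z = excess E + (num_segments E)%:Z.
  by rewrite /num_segments lE lE' hh -!divz_nat ll divzMDl.
have res : res_length (transport E) = res_length E.
  by apply/eqP; rewrite -eqz_nat /res_length lE lE' hh -!modz_nat ll modzMDl.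
split=> //.
rewrite (res_hermiteE pu' hl') (res_hermiteE pu hl) res.
rewrite normal_transport shear_normal_target dir_shear.
rewrite target_transport.
have [B uB hB] := shear_unimodular w (target_shear (normal E)).
by rewrite !hB scalemxAr -mulmxBr hermite_unimodular.
Qed.

Lemma sum_excess : \sum_(E <- ext_edges P w) excess E = 0.
Proof.
have [E1 f1 n1] := facet_exists pP pw.
have [E2 f2 n2] := facet_exists pP (primitiveM_opp pw).
have x1 : E1 \in ext_edges P w.
  by rewrite mem_ext_edges//; apply/asboolP; split=> //; right; left.
have x2 : E2 \in ext_edges P w.
  by rewrite mem_ext_edges//; apply/asboolP; split=> //; right; right.
have nw := dir_norm (primitive_neq0 pw).
have dw : 0 < dotM w w by rewrite /dotM; move: nw; lia.
have dw' : dotM (- w) w < 0 by rewrite /dotM !latME; move: nw; lia.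
have ne : E2 != E1.
  by apply/eqP => e; move: dw'; rewrite -n2 e n1 (lt_gtF dw).
rewrite (big_rem E1)//= (big_rem E2) /=; last first.
  by rewrite mem_rem_uniq ?ext_edges_uniq// inE ne.
rewrite big_seq big1 => [|E].
  rewrite /excess /source_shear /target_shear n1 n2 evN_dir evN_opp_dir !ltxx /=.
  by rewrite dw (lt_gtF dw'); ring.
rewrite mem_rem_uniq ?rem_uniq ?ext_edges_uniq// inE => /andP[ne2].
rewrite mem_rem_uniq ?ext_edges_uniq// inE => /andP[ne1].
rewrite mem_ext_edges// => /asboolP[fE _]; have [pu _ _] := fE.
rewrite /excess target_shearE ?subrr//; apply/eqP => p0.
have [h1 h2] := horizontal_normal pw pu p0.
case: (ltrP 0 (dotM (normal E) w)) => d.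
  by move/eqP: ne1; apply; apply: (facet_inj pP fE f1); rewrite n1 h1.
by move/eqP: ne2; apply; apply: (facet_inj pP fE f2); rewrite n2 h2.
Qed.

Lemma SC_transport : SC_eq (SC P) (SC Q).
Proof.
have [nP [k bP]] := SC_ext_edges pP pw; have [nQ [m bQ]] := SC_ext_edges pQ pw.
have xP E : E \in ext_edges P w -> facet P E by rewrite mem_ext_edges// => /asboolP[].
split.
  rewrite /= nP nQ ext_edges_transport big_map; apply/eqP; rewrite -eqz_nat.
  rewrite !(big_morph Posz PoszD erefl).
  have -> : \sum_(E <- ext_edges P w) (num_segments (transport E))%:Z =
      \sum_(E <- ext_edges P w) (excess E + (num_segments E)%:Z).
    by apply: eq_big_seq => E /xP /transport_num[].
  by rewrite big_split /= sum_excess add0r.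
have bPQ : [seq res_hermite E | E <- ext_edges Q w & (0 < res_length E)%N] =
    [seq res_hermite E | E <- ext_edges P w & (0 < res_length E)%N].
  rewrite ext_edges_transport filter_map -map_comp.
  have -> : [seq E <- ext_edges P w | preim transport (fun E => 0 < res_length E)%N E] =
      [seq E <- ext_edges P w | (0 < res_length E)%N].
    by apply: eq_in_filter => E /xP /transport_num[_ /= -> _].
  apply/eq_in_map => E; rewrite mem_filter => /andP[_ /xP /transport_num[_ _]].
  exact.
rewrite /cyclic_eq /=; move: bPQ; rewrite bP bQ => e.
have [j hj] : exists j, basket Q = rot j (rot m (basket Q)).
  by exists (size (rot m (basket Q)) - m)%N; rewrite -/(rotr m _) rotK.
by exists (rot_add (basket P) k j); rewrite hj e rot_rot_add.
Qed.

End Transport.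

Theorem proposition2p13 (P Q : set spaceNQ) (w : latM) (F : set spaceNQ)
    (R : int -> set spaceNQ) :
  fano P -> fano Q ->
  primitiveM w -> factor P w F -> admissible P w F R ->
  Q = mut P w F R ->
  SC_eq (SC P) (SC Q).
Proof.
move=> /fano_polygon pP /fano_polygon pQ pw [latF Fw _] adm QE.
have [g gw] := frame_exists pw.
have [a Fa hFa] := factor_end gw (or_introl erefl) latF Fw.
have [b Fb hFb] := factor_end gw (or_intror erefl) latF Fw.
apply: (SC_transport pP pQ pw gw (a := a) (b := b)); rewrite QE.
- exact: mut_dominates.
- exact: mut_dominates.
- exact: mut_dominates_vertices.
- exact: mut_dominates_vertices.
Qed.
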